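(* Let $p,q\ge 1$ be integers, and let $A\in\mathbb{C}^{p\times q}$, $B\in\mathbb{C}^{p\times p}$, $C\in\mathbb{C}^{q\times q}$, $D\in\mathbb{C}^{q\times p}$ be constant matrices with $\operatorname{Tr}B=\operatorname{Tr}C$. Let $\sigma$ be the lattice spacing and put $$\xi=\begin{pmatrix} B & A\\ -D & -C\end{pmatrix},\qquad G=\begin{pmatrix} G_{11} & G_{12}\\ G_{21} & G_{22}\end{pmatrix}=e^{\sigma\xi}=I+\sigma\xi+\frac{1}{2!}\sigma^2\xi^2+\cdots,$$ where $G$ is divided into blocks of the same sizes as those of $\xi$. Then the general solution of the continuous matrix Riccati equation with constant coefficients $$\dot W = A+BW+WC+WDW,\qquad W=W(t)\in\mathbb{C}^{p\times q},$$ coincides with the general solution of the discrete matrix Riccati equation $$\overline{W}=\bigl(G_{11}W+G_{12}\bigr)\bigl(G_{21}W+G_{22}\bigr)^{-1},\qquad W=W(t),\quad \overline{W}=W(t+\sigma).$$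
   Context: Here $\dot W=dW/dt$. The matrix $\xi$ is a constant element of the Lie algebra $\mathrm{sl}(p+q,\mathbb{C})$, the condition $\operatorname{Tr}B=\operatorname{Tr}C$ being its tracelessness, and $G=e^{\sigma\xi}\in\mathrm{SL}(p+q,\mathbb{C})$ is the matrix exponential. ''General solution'' is used in the usual sense of the solution depending on the full number of free parameters; for each of the two equations this number is taken to be $pq$, the parameters being the initial conditions. *)

(* Defs.v *)
From HB Require Import structures.
From mathcomp Require Import all_boot all_order all_algebra.
From mathcomp Require Import complex.
From mathcomp Require Import all_classical all_reals all_analysis.

Set Implicit Arguments.
Unset Strict Implicit.
Unset Printing Implicit Defensive.

Import Order.TTheory GRing.Theory Num.Theory.
Import numFieldNormedType.Exports.

Local Open Scope classical_set_scope.
Local Open Scope ring_scope.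

(* The carrier of the structure, rather than the bare type [R[i]], is the type
   on which the normed topology (via [numFieldNormedType]) is found. *)
Definition Cplx (R : realType) : numClosedFieldType := R[i].

Section Exponential.
Context {R : realType} {n : nat}.

Definition expmx (M : 'M[Cplx R]_n) : 'M[Cplx R]_n :=
  limn (fun N => \sum_(0 <= k < N) (k`!%:R)^-1 *: M ^+ k).

End Exponential.

Section Riccati.
Context {R : realType} {p q : nat}.
Local Notation C := (Cplx R).
Local Notation M := 'M[C]_(p, q).

Implicit Types (W : C -> M) (U S T : set C).

Definition xi_mx (A : M) (B : 'M[C]_p) (C0 : 'M[C]_q) (D : 'M[C]_(q, p))
  : 'M[C]_(p + q) := block_mx B A (- D) (- C0).

(* Derivative of [W] at [t] along [U]: for [U] open it is the complex
   derivative, for [U] a real interval the real one (one-sided at an end). *)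
Definition has_derivative_on U W (t : C) (V : M) : Prop :=
  (fun h : C => h^-1 *: (W (t + h) - W t))
    @ within [set h | U (t + h)] 0^' --> V.

(* The time ranges on which a solution of the differential equation is
   considered: connected open subsets of the complex plane (solutions are then
   holomorphic, and are continued around their poles), and intervals of the
   real axis. *)
Definition time_domain U : Prop :=
  (open U /\ connected U) \/
  exists I : interval R, U = [set r%:C%C | r in [set` I]].

Definition continuous_solution A B C0 D U W : Prop :=
  time_domain U /\
  forall t, U t ->
    has_derivative_on U W t
      (A + B *m W t + W t *m C0 + W t *m D *m W t).

Definition discrete_equation (G : 'M[C]_(p + q)) (sigma : C) W (t : C) : Prop :=
  dlsubmx G *m W t + drsubmx G \in unitmx /\
  W (t + sigma) = (ulsubmx G *m W t + ursubmx G)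
                  *m invmx (dlsubmx G *m W t + drsubmx G).

(* Consecutive points of the lattice of spacing [sigma] through [t0]: finitely
   many, a half-lattice, or all of them. *)
Definition lattice_domain (t0 sigma : C) T : Prop :=
  exists J : interval int, T = [set t0 + sigma *~ n | n in [set` J]].

Definition discrete_solution G (t0 sigma : C) T W : Prop :=
  lattice_domain t0 sigma T /\
  forall t, T t -> T (t + sigma) -> discrete_equation G sigma W t.

(* [sol U W] reads "[W] is a solution with domain [U]"; values of [W] outside
   of [U] are irrelevant. The general solution is the family, indexed by the
   [p * q] entries of the initial value [W0] at [t0], of the maximal solutions
   [Phi W0] with domain [S W0]: there is one for each [W0], and every solution
   defined at [t0] is a restriction of a member of the family. *)
Definition general_solution (sol : set C -> (C -> M) -> Prop) (t0 : C)
    (S : M -> set C) (Phi : M -> C -> M) : Prop :=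
  forall W0 : M,
    [/\ sol (S W0) (Phi W0), S W0 t0, Phi W0 t0 = W0 &
        forall U W, sol U W -> U t0 -> W t0 = W0 ->
          U `<=` S W0 /\ (forall t, U t -> W t = Phi W0 t)].

End Riccati.

(* Main.v *)
(** Put [X; Y](t) = e^((t - t0) xi) [W0; 1]. The solution through W(t0) = W0 is
    X Y^-1, defined where Y is invertible. Conversely, along a solution W on U,
    Z = X - W Y satisfies Z' = (B + W D) Z and vanishes at t0, so X = W Y; then
    Y' = - (D W + C) Y, and a kernel vector of Y at some point of U would be in
    the kernel of Y(t0) = 1, so U lies in the domain of X Y^-1. This domain is
    connected because det Y is entire and nonzero at t0, hence has isolated
    zeros. As G maps [X; Y](t) to [X; Y](t + sigma), the discrete equation
    samples the same linear flow, and it can be run backwards since G is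
    invertible. *)
Require Import Defs.
From HB Require Import structures.
From mathcomp Require Import all_boot all_order all_algebra.
From mathcomp Require Import complex.
From mathcomp Require Import all_classical all_reals all_analysis.
From mathcomp Require Import ring lra.

Set Implicit Arguments.
Unset Strict Implicit.
Unset Printing Implicit Defensive.

Import Order.TTheory GRing.Theory Num.Theory.
Import numFieldNormedType.Exports.

Local Open Scope classical_set_scope.
Local Open Scope ring_scope.

(** * Limits of matrices *)

Section MatrixLimits.
Context {K : numFieldType} {T : Type} {F : set_system T} {FF : Filter F}.

(** Uniqueness for Z' = K Z is carried along straight segments inside the time domain, where
    Gronwall's estimate applies to the real function |Z|^2. Restricted to a segment, a complex
    derivative on an open set and a real derivative on an interval look alike, so one argument
    serves both kinds of time domain, with K merely continuous. For the isolated zeros, each entry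
    of Y has around every point a single power series valid on the whole plane, with coefficients
    dominated by K r^n / n!. This class is closed under sums and products, hence contains det Y. The
    global validity of the expansion replaces analytic continuation: a function that is nonzero
    somewhere has a nonzero coefficient at every centre. On the lattice the obstacle is that a
    discrete solution lives on consecutive points. Points of the lattice where Y is invertible may
    lie beyond a lattice point where it is not, so the discrete domain is the maximal run of regular
    lattice points around t0, not the whole intersection. *)

Lemma cvg_mxP m n (f : T -> 'M[K]_(m, n)) (M : 'M[K]_(m, n)) :
  f @ F --> M <-> forall i j, (fun x => f x i j) @ F --> M i j.
Proof.
split=> [fM i j|fM].
  apply: (cvg_comp f (fun A : 'M[K]_(m, n) => A i j) fM).
  exact: coord_continuous.
apply/cvg_ballP => e e0.
have /filter_forall : forall i, \forall x \near F, forall j, ball (M i j) e (f x i j).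
  by move=> i; apply: filter_forall => j; exact: ((cvg_ballP _ _).1 (fM i j)).
by apply: filterS => x fx; split.
Qed.

Lemma cvg_mulmx m n p (f : T -> 'M[K]_(m, n)) (g : T -> 'M[K]_(n, p))
    (M : 'M[K]_(m, n)) (N : 'M[K]_(n, p)) :
  f @ F --> M -> g @ F --> N -> (fun x => f x *m g x) @ F --> M *m N.
Proof.
move=> /cvg_mxP fM /cvg_mxP gN; apply/cvg_mxP => i j.
under eq_fun do rewrite mxE; rewrite mxE.
apply: (cvg_big (op := +%R)) => [|k _]; first exact: add_continuous.
exact: cvgM.
Qed.

Lemma cvg_det n (f : T -> 'M[K]_n) (M : 'M[K]_n) :
  f @ F --> M -> (fun x => \det (f x)) @ F --> \det M.
Proof.
move=> /cvg_mxP fM; rewrite /determinant.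
apply: (cvg_big (op := +%R)) => [|s _]; first exact: add_continuous.
apply: cvgM; first exact: cvg_cst.
by apply: (cvg_big (@mul_continuous K)) => i _; exact: fM.
Qed.

(** [invmx] leaves a singular matrix unchanged, so Cramer's formula describes [invmx (f x)] only
    eventually, once the determinant stays off 0. The adjugate is then handled entrywise by
    [cvg_det]. *)
Lemma cvg_invmx n (f : T -> 'M[K]_n) (M : 'M[K]_n) : M \in unitmx ->
  f @ F --> M -> (fun x => invmx (f x)) @ F --> invmx M.
Proof.
move=> Mu fM.
have detM : \det M != 0 by rewrite -unitfE -unitmxE.
have fu : \forall x \near F, f x \in unitmx.
  have := cvg_det fM => /cvgrPdist_lt /(_ `|\det M|).
  rewrite normr_gt0 => /(_ detM); apply: filterS => x.
  rewrite unitmxE unitfE; apply: contraTneq => ->.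
  by rewrite subr0 ltxx.
have adjM : (fun x => \adj (f x)) @ F --> \adj M.
  apply/cvg_mxP => i j; under eq_fun do rewrite mxE; rewrite mxE /cofactor.
  apply: cvgM; first exact: cvg_cst.
  apply/cvg_det/cvg_mxP => k l; rewrite !mxE.
  under eq_fun do rewrite !mxE; exact: ((cvg_mxP _ _).1 fM).
rewrite {2}/invmx Mu; 
apply: (@cvg_trans _ ((fun x => (\det (f x))^-1 *: \adj (f x)) @ F)).
  by apply: near_eq_cvg; apply: filterS fu => x fxu; rewrite /invmx fxu.
by apply: cvgZ => //; apply: cvgV => //; exact: cvg_det.
Qed.

End MatrixLimits.

(** * Complex limits through real and imaginary parts *)

Section ComplexLimits.
Context {R : realType}.
Local Notation C := (Cplx R).

Lemma normC_split (z : C) : `|z| <= (`|complex.Re z| + `|complex.Im z|)%:C%C.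
Proof.
rewrite {1}(complexE z) (le_trans (ler_normD _ _))// rmorphD/= normrM.
by rewrite !normc_def/= !(expr0n, addr0, add0r, expr1n, sqrtr1, mul1r) !sqrtr_sqr.
Qed.

(** The norm on [Cplx R] takes its values in [Cplx R] itself; this rewriting moves an estimate to
    the totally ordered field [R]. *)
Lemma normC_real (z : C) : `|z| = (complex.Re `|z|)%:C%C.
Proof. by rewrite normc_def. Qed.

Lemma Re_norm_ge0 (z : C) : 0 <= complex.Re `|z|.
Proof. by rewrite -ler0c -normC_real. Qed.

Lemma normC_entry_le m n (M : 'M[C]_(m, n)) i j :
  `|M i j| <= (\sum_k \sum_l complex.Re `|M k l|)%:C%C.
Proof.
rewrite normC_real lecR (bigD1 i)//= (bigD1 j)//= -addrA lerDl addr_ge0//.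
  by apply: sumr_ge0 => l _; exact: Re_norm_ge0.
by apply: sumr_ge0 => k _; apply: sumr_ge0 => l _; exact: Re_norm_ge0.
Qed.

Lemma normC_i : `|'i%C : C| = 1.
Proof. by rewrite normc_def/= expr0n/= add0r expr1n sqrtr1. Qed.

Lemma cvg_complex (T : Type) (F : set_system T) {FF : Filter F} (f : T -> C)
    (x y : R) :
  (fun t => complex.Re (f t)) @ F --> x -> (fun t => complex.Im (f t)) @ F --> y ->
  f @ F --> (Complex x y : C).
Proof.
move=> /cvgrPdist_lt fx /cvgrPdist_lt fy; apply/cvgrPdist_lt => e e0.
have eE : e = (complex.Re e)%:C%C by rewrite RRe_real// ger0_real// ltW.
have e2 : 0 < complex.Re e / 2 by rewrite divr_gt0// -ltcR -eE.
apply: filterS2 (fx _ e2) (fy _ e2) => t xt yt.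
rewrite (le_lt_trans (normC_split _))// eE ltcR [ltRHS]splitr.
have -> : Complex x y - f t = Complex (x - complex.Re (f t)) (y - complex.Im (f t)).
  by case: (f t).
exact: ltrD.
Qed.

Lemma cvg_Re (T : Type) (F : set_system T) {FF : Filter F} (f : T -> C) (l : C) :
  f @ F --> l -> (fun t => complex.Re (f t)) @ F --> complex.Re l.
Proof.
move=> /cvgrPdist_lt fl; apply/cvgrPdist_lt => e e0.
have := fl e%:C%C; rewrite ltcR => /(_ e0); apply: filterS => t lt.
rewrite -ltcR (le_lt_trans _ lt)// -(raddfB (@complex.Re R : Rcomplex R -> R)).
exact: normc_ge_Re.
Qed.

Lemma cvg_norm_dominated (T : Type) (F : set_system T) {FF : Filter F}
    (f : T -> C) (b : T -> R) :
  (forall t, `|f t| <= (b t)%:C%C) -> b @ F --> 0 -> f @ F --> 0.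
Proof.
move=> fb /cvgrPdist_lt b0; apply/cvgrPdist_lt => e e0.
have eE : e = (complex.Re e)%:C%C by rewrite RRe_real// ger0_real// ltW.
have := b0 (complex.Re e); rewrite -ltcR -eE => /(_ e0); apply: filterS => t.
rewrite !sub0r !normrN => bt; rewrite (le_lt_trans (fb t))// eE ltcR.
by rewrite (le_lt_trans (ler_norm _)).
Qed.

Lemma norm_series_le (a : nat -> C) (b : nat -> R) (l : C) (B : R) :
  (forall n, `|a n| <= (b n)%:C%C) -> series a @ \oo --> l ->
  series b @ \oo --> B -> `|l| <= B%:C%C.
Proof.
move=> ab al bB.
have bn n : 0 <= b n by rewrite -ler0c (le_trans _ (ab n)).
have sa n : `|series a n| <= B%:C%C.
  rewrite /series/= (le_trans (ler_norm_sum _ _ _))//.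
  rewrite (le_trans (ler_sum _ (fun i _ => ab i)))// -rmorph_sum/= lecR.
  have : nondecreasing_seq (series b) by apply: nondecreasing_series.
  move=> /nondecreasing_cvgn_le /(_ (cvgP _ bB) n).
  by rewrite (cvg_lim _ bB).
(* The order on C is partial: a failing [<=] turns into [<] only between real elements. *)
have Breal : B%:C%C \is Num.real by apply/complex_realP; exists B.
rewrite real_leNgt ?normr_real//; apply/negP => Bl.
have /cvgrPdist_lt := al => /(_ (`|l| - B%:C%C)).
rewrite subr_gt0 => /(_ Bl)[N _ /(_ N (leqnn N))]/=.
apply/negP; rewrite -real_leNgt ?realB ?normr_real//.
by rewrite (le_trans _ (lerB_dist _ _))// lerB.
Qed.

(** The real and imaginary parts are absolutely convergent real series by comparison with [b]; the
    limit is assembled from their sums. *)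
Lemma cvg_series_dominated (a : nat -> C) (b : nat -> R) :
  (forall n, `|a n| <= (b n)%:C%C) -> cvgn (series b) ->
  exists l : C, series a @ \oo --> l.
Proof.
move=> ab cb.
have bn n : 0 <= b n by rewrite -ler0c (le_trans _ (ab n)).
have cr (p : C -> R) : (forall z : C, `|p z|%:C%C <= `|z|) ->
    cvgn (series (fun n => p (a n))).
  move=> pz; apply: normed_cvg; apply: (series_le_cvg _ bn _ cb) => n//=.
  by rewrite -lecR (le_trans (pz _)).
have /cvg_ex[x cx] := cr (@complex.Re R) (@normc_ge_Re R).
(* Up to sign, the imaginary part of z is the real part of i z. *)
have Imle (z : C) : `|complex.Im z|%:C%C <= `|z|.
  have := normc_ge_Re (z * 'i%C); rewrite ReiNIm normrN normrM normC_i mulr1.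
  exact.
have /cvg_ex[y cy] := cr (@complex.Im R) Imle.
exists (Complex x y : C); apply: cvg_complex.
  rewrite (_ : (fun t => _) = series (fun n => complex.Re (a n)))//.
  by apply/funext => n; rewrite /series/= (raddf_sum (@complex.Re R : Rcomplex R -> R)).
rewrite (_ : (fun t => _) = series (fun n => complex.Im (a n)))//.
by apply/funext => n; rewrite /series/= (raddf_sum (@complex.Im R : Rcomplex R -> R)).
Qed.

End ComplexLimits.

(** * Series of exponential type *)

Lemma exp_coeffD (R : realType) (x y : R) n :
  exp_coeff (x + y) n = \sum_(0 <= i < n.+1) exp_coeff x i * exp_coeff y (n - i)%N.
Proof.
rewrite !exp_coeffE addrC exprDn mulr_sumr big_mkord.
apply: eq_bigr => -[i/=]; rewrite ltnS => ile _.
have fn0 k : k`!%:R != 0 :> R by rewrite pnatr_eq0 -lt0n fact_gt0.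
have := bin_fact ile => /(congr1 (fun k => k%:R : R)); rewrite !natrM => <-.
have b0 : 'C(n, i)%:R != 0 :> R by rewrite pnatr_eq0 -lt0n bin_gt0.
by rewrite -mulr_natr; field; rewrite !fn0.
Qed.

(** The square i, j < N minus the triangle i + j < N leaves the corner i + j >= N. Stated in any
    abelian group, it serves both the complex series and their real majorants. *)
Lemma cauchy_product_remainder (V : zmodType) (f : nat -> nat -> V) N :
  \sum_(0 <= i < N) \sum_(0 <= j < N) f i j -
  \sum_(0 <= n < N) \sum_(0 <= i < n.+1) f i (n - i)%N =
  \sum_(0 <= i < N) \sum_(N - i <= j < N) f i j.
Proof.
have -> : \sum_(0 <= n < N) \sum_(0 <= i < n.+1) f i (n - i)%N =
    \sum_(0 <= i < N) \sum_(0 <= j < N - i) f i j.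
  elim: N => [|N IH]; first by rewrite !big_geq.
  rewrite big_nat_recr//= IH [RHS]big_nat_recr//= subSnn big_nat1.
  rewrite [X in _ + X]big_nat_recr//= subnn addrA; congr (_ + _).
  rewrite -big_split/= big_nat [RHS]big_nat; apply: eq_bigr => i /andP[_ iN].
  by rewrite subSn 1?ltnW// big_nat_recr.
rewrite -sumrB; apply: eq_bigr => i _.
apply/eqP; rewrite subr_eq addrC; apply/eqP.
by rewrite [LHS](@big_cat_nat _ _ _ (N - i)%N)//= leq_subr.
Qed.

Section ExponentialType.
Context {R : realType}.
Local Notation C := (Cplx R).
Implicit Types (a b : nat -> C) (K r : R).

(** Domination by the Taylor coefficients of K e^(r z). This is stronger than an infinite radius of
    convergence, and gives sums, Cauchy products, shifts and dilations explicit majorants of the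
    same shape. *)
Definition exp_type a := exists K r,
  [/\ 0 <= K, 0 <= r & forall n, `|a n| <= (K * exp_coeff r n)%:C%C].

Definition cauchy_product a b n : C := \sum_(0 <= i < n.+1) a i * b (n - i)%N.

Lemma cvg_series_exp_coeffM K r :
  series (fun n => K * exp_coeff r n) @ \oo --> K * expR r.
Proof.
have -> : series (fun n => K * exp_coeff r n) = (fun N => K * series (exp_coeff r) N).
  by apply/funext => N; rewrite /series/= mulr_sumr.
by apply: cvgMr; exact: is_cvg_series_exp_coeff.
Qed.

Lemma exp_type_cvg a : exp_type a -> exists l : C, series a @ \oo --> l.
Proof.
move=> [K [r [_ _ aK]]]; apply: (cvg_series_dominated aK).
by apply: cvgP; exact: cvg_series_exp_coeffM.
Qed.

Lemma exp_typeD a b : exp_type a -> exp_type b -> exp_type (fun n => a n + b n).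
Proof.
move=> [K [r [K0 r0 aK]]] [L [s [L0 s0 bL]]].
exists (K + L), (Num.max r s); split=> [||n]; first exact: addr_ge0.
  by rewrite le_max r0.
have mono t : 0 <= t -> t <= Num.max r s -> exp_coeff t n <= exp_coeff (Num.max r s) n.
  move=> t0 tm; rewrite !exp_coeffE ler_wpM2l// ?invr_ge0// lerXn2r// nnegrE//.
  exact: le_trans tm.
rewrite (le_trans (ler_normD _ _))// (le_trans (lerD (aK n) (bL n)))// -rmorphD/= lecR.
by rewrite mulrDl lerD// ler_wpM2l// mono// le_max lexx ?orbT.
Qed.

Lemma exp_typeMX a (h : C) : exp_type a -> exp_type (fun n => a n * h ^+ n).
Proof.
move=> [K [r [K0 r0 aK]]]; have h0 := Re_norm_ge0 h.
exists K, (complex.Re `|h| * r); split=> //; first exact: mulr_ge0.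
move=> n; rewrite normrM normrX !exp_coeffE exprMn.
rewrite (_ : K * _ = (K * exp_coeff r n) * (complex.Re `|h|) ^+ n); last first.
  by rewrite exp_coeffE; ring.
by rewrite rmorphM/= rmorphXn/= -normC_real ler_wpM2r ?exprn_ge0.
Qed.

(** By the binomial theorem the majorants multiply like exponentials: constants multiply and rates
    add. *)
Lemma exp_type_cauchy_product a b :
  exp_type a -> exp_type b -> exp_type (cauchy_product a b).
Proof.
move=> [K [r [K0 r0 aK]]] [L [s [L0 s0 bL]]].
exists (K * L), (r + s); split=> [||n]; [exact: mulr_ge0|exact: addr_ge0|].
rewrite /cauchy_product (le_trans (ler_norm_sum _ _ _))//.
rewrite exp_coeffD mulr_sumr rmorph_sum/=.
apply: ler_sum => i _; rewrite normrM mulrACA rmorphM/=.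
by apply: ler_pM.
Qed.

Lemma cvg_cauchy_product a b (l m : C) : exp_type a -> exp_type b ->
  series a @ \oo --> l -> series b @ \oo --> m ->
  series (cauchy_product a b) @ \oo --> l * m.
Proof.
move=> [K [r [K0 r0 aK]]] [L [s [L0 s0 bL]]] al bm.
pose u n := K * exp_coeff r n; pose v n := L * exp_coeff s n.
(* The defect of the product is dominated termwise by that of the real
   exponential series, which tends to 0 by [expRD]. *)
have prodE (T : comNzRingType) (f g : nat -> T) N : series f N * series g N -
    \sum_(0 <= n < N) \sum_(0 <= i < n.+1) f i * g (n - i)%N =
    \sum_(0 <= i < N) \sum_(N - i <= j < N) f i * g j.
  rewrite -cauchy_product_remainder; congr (_ - _); rewrite /series/= mulr_suml.
  by apply: eq_bigr => i _; rewrite mulr_sumr.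
have : (fun N => series a N * series b N - series (cauchy_product a b) N) @ \oo --> 0.
  apply: (@cvg_norm_dominated _ _ _ _ _
    (fun N => series u N * series v N - series (fun n => K * L * exp_coeff (r + s) n) N)).
    move=> N; rewrite /cauchy_product [X in `|_ - X|]/series/= prodE.
    have -> : series (fun n => K * L * exp_coeff (r + s) n) N =
        \sum_(0 <= n < N) \sum_(0 <= i < n.+1) u i * v (n - i)%N.
      rewrite /series/=; apply: eq_bigr => n _; rewrite exp_coeffD mulr_sumr.
      by apply: eq_bigr => i _; rewrite /u /v mulrACA.
    rewrite prodE rmorph_sum/= (le_trans (ler_norm_sum _ _ _))//.
    apply: ler_sum => i _; rewrite rmorph_sum/= (le_trans (ler_norm_sum _ _ _))//.
    by apply: ler_sum => j _; rewrite normrM rmorphM/=; apply: ler_pM.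
  have -> : 0 = (K * expR r) * (L * expR s) - K * L * expR (r + s) :> R.
    by rewrite expRD; ring.
  by apply: cvgB; [apply: cvgM|]; exact: cvg_series_exp_coeffM.
move=> H; have -> : series (cauchy_product a b) = (fun N => series a N * series b N -
    (series a N * series b N - series (cauchy_product a b) N)).
  by apply/funext => N; rewrite opprB addrCA subrr addr0.
by rewrite -[l * m]subr0; exact: (cvgB (cvgM al bm) H).
Qed.

(** Since (n + m)! >= n!, the surplus factor r^m can be moved into the constant. *)
Lemma exp_type_shift a m : exp_type a -> exp_type (fun n => a (n + m)%N).
Proof.
move=> [K [r [K0 r0 aK]]]; exists (K * r ^+ m), r; split=> [||n//].
- by rewrite mulr_ge0// exprn_ge0.
- by [].
rewrite (le_trans (aK _))// lecR -mulrA ler_wpM2l// !exp_coeffE mulrCA -exprD addnC.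
rewrite ler_wpM2r ?exprn_ge0//.
by rewrite lef_pV2 ?posrE ?ltr0n ?fact_gt0// ler_nat leq_fact ?leq_addl.
Qed.

(** The remainder is h^m times the shifted series, and in the unit disc the powers of h in the
    latter are at most 1, so the sum K e^r of the majorant bounds it uniformly. Taking m = 1 yields
    the value at 0, m = 2 the derivative there, and m one past the leading coefficient the isolation
    of zeros. *)
Lemma exp_type_remainder a m : exp_type a -> exists2 B : C, 0 <= B &
  forall h l : C, `|h| <= 1 -> series (fun n => a n * h ^+ n) @ \oo --> l ->
    `|l - \sum_(0 <= k < m) a k * h ^+ k| <= `|h| ^+ m * B.
Proof.
move=> /(exp_type_shift m) aT; have [K [r [K0 r0 aK]]] := aT.
exists (K * expR r)%:C%C; first by rewrite ler0c mulr_ge0// expR_ge0.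
move=> h l h1 hl.
have [l' hl'] := exp_type_cvg (exp_typeMX h aT).
have -> : l - \sum_(0 <= k < m) a k * h ^+ k = h ^+ m * l'.
  have : (fun N => series (fun n => a n * h ^+ n) (N + m)%N) @ \oo --> l.
    by move: hl; rewrite -(cvg_shiftn m).
  have -> : (fun N => series (fun n => a n * h ^+ n) (N + m)%N) =
     (fun N => \sum_(0 <= k < m) a k * h ^+ k +
        h ^+ m * series (fun n => a (n + m)%N * h ^+ n) N).
    apply/funext => N; rewrite /series/= (big_cat_nat (leq0n m))//= ?leq_addl//.
    congr (_ + _); rewrite -{1}[m]add0n big_addn addnK mulr_sumr.
    by apply: eq_bigr => i _; rewrite exprD; ring.
  move=> H; rewrite (cvg_unique (@norm_hausdorff _ C) H (cvgD (cvg_cst _) (cvgMr hl'))).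
  by rewrite addrC addKr.
rewrite normrM normrX ler_wpM2l ?exprn_ge0//.
apply: (@norm_series_le _ (fun n => a (n + m)%N * h ^+ n)
  (fun n => K * exp_coeff r n)) => // [n|]; last exact: cvg_series_exp_coeffM.
by rewrite normrM (le_trans _ (aK n))// ler_piMr// normrX exprn_ile1.
Qed.

End ExponentialType.

(** * Entire functions *)

Section EntireFunctions.
Context {R : realType}.
Local Notation C := (Cplx R).
Implicit Types (f g : C -> C) (t h : C).

(* Stable under products, hence under determinants, as [exp_type] is under
   Cauchy products. *)
Definition entire_at t f := exists2 a : nat -> C, exp_type a &
  forall h, series (fun n => a n * h ^+ n) @ \oo --> f (t + h).

Lemma entire_at_cst t (c : C) : entire_at t (fun=> c).
Proof.
exists (fun n => if n is 0 then c else 0).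
  exists (complex.Re `|c|), 0; split=> // [|[|n]].
  - exact: Re_norm_ge0.
  - by rewrite exp_coeffE/= fact0 invr1 expr0 !mulr1 -normC_real.
  - by rewrite normr0 exp_coeffE/= exprS mul0r !mulr0.
(* The partial sum at index 0 is empty; the sequence is constant from index 1 on. *)
move=> h; rewrite -(cvg_shiftn 1)/=.
rewrite (_ : (fun n : nat => _) = cst c); first exact: (@cvg_cst C).
apply/funext => n; rewrite /series/= addn1 big_nat_recl//= mulr1.
by rewrite big1 ?addr0// => i _; rewrite mul0r.
Qed.

Lemma entire_atD t f g :
  entire_at t f -> entire_at t g -> entire_at t (fun z => f z + g z).
Proof.
move=> [a aT af] [b bT bg]; exists (fun n => a n + b n); first exact: exp_typeD.
move=> h; rewrite (_ : series _ = (fun N => series (fun n => a n * h ^+ n) N +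
    series (fun n => b n * h ^+ n) N)); first exact: (cvgD (af h) (bg h)).
apply/funext => N; rewrite /series/= -big_split/=.
by apply: eq_bigr => i _; rewrite mulrDl.
Qed.

Lemma entire_atM t f g :
  entire_at t f -> entire_at t g -> entire_at t (fun z => f z * g z).
Proof.
move=> [a aT af] [b bT bg]; exists (cauchy_product a b).
  exact: exp_type_cauchy_product.
move=> h; rewrite (_ : (fun n => cauchy_product a b n * h ^+ n) =
    cauchy_product (fun n => a n * h ^+ n) (fun n => b n * h ^+ n)).
  exact: (cvg_cauchy_product (exp_typeMX h aT) (exp_typeMX h bT) (af h) (bg h)).
apply/funext => n; rewrite /cauchy_product mulr_suml.
rewrite !big_mkord; apply: eq_bigr => -[i/=]; rewrite ltnS => ile _.
by rewrite mulrACA -exprD subnKC.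
Qed.

Lemma entire_at_sum t (I : Type) (r : seq I) (P : pred I) (F : I -> C -> C) :
  (forall i, entire_at t (F i)) ->
  entire_at t (fun z => \sum_(i <- r | P i) F i z).
Proof.
move=> Ft; elim: r => [|i r IH].
  by under eq_fun do rewrite big_nil; exact: entire_at_cst.
under eq_fun do rewrite big_cons; case: (P i); last exact: IH.
exact: (@entire_atD t (F i) (fun z => \sum_(j <- r | P j) F j z) (Ft i) IH).
Qed.

Lemma entire_at_prod t (I : Type) (r : seq I) (P : pred I) (F : I -> C -> C) :
  (forall i, entire_at t (F i)) ->
  entire_at t (fun z => \prod_(i <- r | P i) F i z).
Proof.
move=> Ft; elim: r => [|i r IH].
  by under eq_fun do rewrite big_nil; exact: entire_at_cst.
under eq_fun do rewrite big_cons; case: (P i); last exact: IH.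
exact: (@entire_atM t (F i) (fun z => \prod_(j <- r | P j) F j z) (Ft i) IH).
Qed.

Lemma entire_at_det t n (F : C -> 'M[C]_n) :
  (forall i j, entire_at t (fun z => F z i j)) -> entire_at t (fun z => \det (F z)).
Proof.
move=> Ft; rewrite /determinant; apply: entire_at_sum => s.
apply: entire_atM; first exact: entire_at_cst.
by apply: entire_at_prod => i; exact: Ft.
Qed.

(** Let a_m be the first nonzero coefficient. A zero at t + h with 0 < |h| < 1 would force |a_m| <=
    |h| B, where B bounds the remainder of order m + 1; this fails for small h. *)
Lemma entire_at_isolated_zeros t f : entire_at t f -> (exists z, f z != 0) ->
  \forall h \near 0^', f (t + h) != 0.
Proof.
move=> [a aT af] [z fz].
have [n an] : exists n, a n != 0.
  apply: contrapT => an; move/eqP: fz; apply.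
  have a0 n : a n = 0 by apply: contrapT => /eqP h; apply: an; exists n.
  rewrite -[z](addrNK t) addrC.
  apply: (cvg_unique (@norm_hausdorff _ C) (af (z - t))).
  rewrite (_ : series _ = cst 0); first exact: (@cvg_cst C).
  by apply/funext => N; rewrite /series/= big1// => i _; rewrite a0 mul0r.
have {n an}[m am amin] := ex_minnP (ex_intro (fun n => a n != 0) n an).
have [B B0 aB] := exp_type_remainder m.+1 aT.
(* [B] may be 0; dividing by [B + 1] keeps the radius meaningful. *)
have e0 : 0 < `|a m| / (B + 1) by rewrite divr_gt0 ?normr_gt0// ltr_wpDl.
have h1 : \forall h \near (0 : C)^', `|h| < 1 by exact: dnbhs0_lt.
have h2 : \forall h \near (0 : C)^', `|h| < `|a m| / (B + 1) by exact: dnbhs0_lt.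
have h3 : \forall h \near (0 : C)^', h != 0 by exact: nbhs_dnbhs_neq.
near=> h.
have hn0 : h != 0 by near: h.
apply/eqP => fh0; have := aB h _ _ (af h); rewrite fh0 => H.
have {H} : `|h| ^+ m * `|a m| <= `|h| ^+ m * (`|h| * B).
  rewrite mulrA -exprSr -normrX mulrC -normrM (le_trans _ (H _))//; last first.
    by apply/ltW; near: h.
  rewrite sub0r normrN big_nat_recr//= big_nat big1 ?add0r// => i /andP[_ im].
  have [->|/amin] := eqVneq (a i) 0; first by rewrite mul0r.
  by rewrite leqNgt im.
rewrite ler_pM2l ?exprn_gt0 ?normr_gt0//.
apply/negP; rewrite -real_ltNge ?realM ?normr_real ?ger0_real//.
rewrite (@le_lt_trans _ _ (`|h| * (B + 1)))// ?ler_wpM2l ?lerDl//.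
rewrite -ltr_pdivlMr; first by near: h.
by rewrite ltr_wpDl.
Unshelve. all: by end_near. Qed.

End EntireFunctions.

(** * The matrix exponential *)

Section MatrixExponential.
Context {R : realType} {n : nat}.
Local Notation C := (Cplx R).
Implicit Types (M : 'M[C]_n) (s t h : C).

Definition expmx_coeff M (i j : 'I_n) (k : nat) : C := (k`!%:R)^-1 * (M ^+ k) i j.

(** If [c] bounds every entry of M, an entry of a product is a sum of n terms, so the entries of M^k
    are at most (n c)^k; this gives the rate n c. *)
Lemma exp_type_expmx_coeff M i j : exp_type (expmx_coeff M i j).
Proof.
pose c : R := \sum_i \sum_j complex.Re `|M i j|.
have c0 : 0 <= c by apply: sumr_ge0 => k _; apply: sumr_ge0 => l _; exact: Re_norm_ge0.
have Mc k l : `|M k l| <= c%:C%C by exact: normC_entry_le.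
exists 1, (n%:R * c); split=> [//||k]; first by rewrite mulr_ge0.
rewrite mul1r /expmx_coeff exp_coeffE/= normrM rmorphM/= normfV normr_nat.
rewrite fmorphV/= rmorph_nat ler_wpM2l ?invr_ge0//.
elim: k i j => [|k IH] i j.
  by rewrite !expr0 mxE; case: (_ == _); rewrite ?normr0 ?normr1.
rewrite exprS mxE (le_trans (ler_norm_sum _ _ _))//.
rewrite (_ : ((n%:R * c) ^+ k.+1)%:C%C =
    \sum_(l < n) c%:C%C * ((n%:R * c) ^+ k)%:C%C); last first.
  by rewrite sumr_const card_ord exprS !rmorphM/= rmorph_nat -[RHS]mulr_natl mulrA.
by apply: ler_sum => l _; rewrite normrM ler_pM.
Qed.

Lemma exprZmx M h k : (h *: M) ^+ k = h ^+ k *: M ^+ k.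
Proof.
elim: k => [|k IH]; first by rewrite !expr0 scale1r.
rewrite !exprS IH -[LHS]/((h *: M) *m (h ^+ k *: M ^+ k)).
by rewrite -scalemxAr -scalemxAl scalerA mulrC.
Qed.

(** [expmx] is a [lim], which means nothing before convergence is known. The entrywise limits are
    therefore chosen first, collected in a matrix, and identified with [expmx] by uniqueness of
    limits. *)
Lemma cvg_expmxZ M h i j :
  series (fun k => expmx_coeff M i j k * h ^+ k) @ \oo --> expmx (h *: M) i j.
Proof.
have H k l : exists z : C, series (fun m => expmx_coeff M k l m * h ^+ m) @ \oo --> z.
  by apply: exp_type_cvg; apply: exp_typeMX; exact: exp_type_expmx_coeff.
pose L : 'M[C]_n := \matrix_(k, l)
  xget 0 [set z : C | series (fun m => expmx_coeff M k l m * h ^+ m) @ \oo --> z].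
have HL k l : series (fun m => expmx_coeff M k l m * h ^+ m) @ \oo --> L k l.
  by rewrite mxE; exact: (xgetPex 0 (H k l)).
suff -> : expmx (h *: M) = L by exact: HL.
apply: (cvg_lim (@norm_hausdorff _ _)).
apply/cvg_mxP => k l; have := HL k l; apply: cvg_trans.
rewrite (_ : (fun N => _) = series (fun m => expmx_coeff M k l m * h ^+ m))//.
apply/funext => N; rewrite summxE/= /series/=; apply: eq_bigr => m _.
by rewrite exprZmx !mxE /expmx_coeff mulrA mulrAC.
Qed.

(** One Cauchy product is formed for each intermediate index k. Summing over k merges the entries of
    M^l and M^(m-l) into one of M^m, which leaves the binomial theorem for the scalars s and t. *)
Lemma expmxD M s t : expmx ((s + t) *: M) = expmx (s *: M) *m expmx (t *: M).
Proof.
apply/matrixP => i j.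
apply: (cvg_unique (@norm_hausdorff _ C) (@cvg_expmxZ M (s + t) i j)).
rewrite mxE.
pose a k := cauchy_product (fun m => expmx_coeff M i k m * s ^+ m)
  (fun m => expmx_coeff M k j m * t ^+ m).
rewrite (_ : series _ = (fun N => \sum_k series (a k) N)).
  apply: (cvg_big (@add_continuous C)) => k _.
  by apply: cvg_cauchy_product; [apply: exp_typeMX; exact: exp_type_expmx_coeff..| |];
    exact: cvg_expmxZ.
apply/funext => N; rewrite /series/= exchange_big/=; apply: eq_bigr => m _.
rewrite /a /cauchy_product exchange_big/= /expmx_coeff addrC exprDn mulr_sumr big_mkord.
apply: eq_bigr => -[l/=]; rewrite ltnS => lm _.
have -> : (M ^+ m) i j = \sum_k (M ^+ l) i k * (M ^+ (m - l)) k j.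
  by rewrite -{1}(subnKC lm) exprD mxE.
rewrite mulr_sumr mulr_suml; apply: eq_bigr => k _.
rewrite -[_ *+ 'C(m, l)]mulr_natr.
have fn0 o : o`!%:R != 0 :> C by rewrite pnatr_eq0 -lt0n fact_gt0.
have := bin_fact lm => /(congr1 (fun k => k%:R : C)); rewrite !natrM => <-.
have b0 : 'C(m, l)%:R != 0 :> C by rewrite pnatr_eq0 -lt0n bin_gt0.
by field; rewrite !fn0.
Qed.

Lemma expmx0 M : expmx (0 *: M) = 1%:M.
Proof.
apply/matrixP => i j.
have [B _ HB] := exp_type_remainder 1 (@exp_type_expmx_coeff M i j).
have := HB 0 _ _ (@cvg_expmxZ M 0 i j); rewrite normr0 => /(_ ler01).
rewrite big_nat1 expr1 mul0r normr_le0 subr_eq0 => /eqP ->.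
by rewrite /expmx_coeff fact0 invr1 !expr0 mul1r mulr1.
Qed.

Lemma expmx_unit M h : expmx (h *: M) \in unitmx.
Proof.
have : expmx (h *: M) *m expmx (- h *: M) = 1%:M by rewrite -expmxD subrr expmx0.
by move: (expmx _) (expmx _) => E F /mulmx1_unit[].
Qed.

(** The second-order remainder divided by h is at most |h| B. Together with the group law this gives
    the derivative at every point. *)
Lemma expmx_derivative0 M :
  (fun h => h^-1 *: (expmx (h *: M) - 1%:M)) @ 0^' --> M.
Proof.
apply/cvg_mxP => i j.
have [B B0 HB] := exp_type_remainder 2 (@exp_type_expmx_coeff M i j).
have h3 : \forall h \near (0 : C)^', h != 0 by exact: nbhs_dnbhs_neq.
have h1 : \forall h \near (0 : C)^', `|h| < 1 by exact: dnbhs0_lt.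
apply/cvgrPdist_lt => e e0.
have h2 : \forall h \near (0 : C)^', `|h| < e / (B + 1).
  by apply: dnbhs0_lt; rewrite divr_gt0// ltr_wpDl.
near=> h.
have hn0 : h != 0 by near: h.
have := HB h _ (ltW _) (@cvg_expmxZ M h i j).
rewrite big_nat_recr//= big_nat1 /expmx_coeff fact0 !invr1 !expr0 expr1 !mul1r mulr1.
move=> H; rewrite !mxE distrC.
rewrite (_ : _ - M i j = h^-1 *
    (expmx (h *: M) i j - ((1%:M : 'M[C]_n) i j + M i j * h))).
  rewrite normrM normfV ltr_pdivrMl ?normr_gt0//.
  rewrite (le_lt_trans (H _))//; first by near: h.
  rewrite expr2 -mulrA ltr_pM2l ?normr_gt0//.
  rewrite (@le_lt_trans _ _ (`|h| * (B + 1)))// ?ler_wpM2l ?lerDl//.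
  by rewrite -ltr_pdivlMr; [near: h|rewrite ltr_wpDl].
by rewrite !mxE; field.
Unshelve. all: by end_near. Qed.

End MatrixExponential.

(** * Derivatives along a set *)

Section DerivativeAlong.
Context {R : realType}.
Local Notation C := (Cplx R).
Implicit Types (U : set C) (t h : C).

Definition continuous_along (V : topologicalType) U (f : C -> V) t :=
  (fun h => f (t + h)) @ within [set h | U (t + h)] (nbhs 0) --> f t.

Lemma cvg_eq_near (T : Type) (V : topologicalType) (F : set_system T)
    {FF : Filter F} (f g : T -> V) (l : V) :
  (\forall x \near F, f x = g x) -> f @ F --> l -> g @ F --> l.
Proof. by move=> fg; apply: cvg_trans; exact: near_eq_cvg. Qed.

(** Merely a [Filter]: when t is isolated in U, as in a one-point interval, the punctured filter is
    improper and every limit along it holds vacuously. *)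
Lemma dnbhs_within_filter U t : Filter (within [set h | U (t + h)] (0 : C)^').
Proof. exact: within_filter. Qed.
Local Existing Instance dnbhs_within_filter.

Lemma nbhs_within_filter U t : Filter (within [set h | U (t + h)] (nbhs (0 : C))).
Proof. exact: within_filter. Qed.
Local Existing Instance nbhs_within_filter.

Lemma dnbhs_within_neq0 U t :
  \forall h \near within [set h | U (t + h)] (0 : C)^', h != 0.
Proof. 
rewrite near_withinE; have : \forall h \near (0 : C)^', h != 0 by exact: nbhs_dnbhs_neq.
exact: filterS. Qed.

Lemma has_derivative_on_punctured m n U (W : C -> 'M[C]_(m, n)) t V :
  has_derivative_on U W t V ->
  (fun h => W (t + h)) @ within [set h | U (t + h)] 0^' --> W t.
Proof.
move=> dW; have id0 : (fun h : C => h) @ within [set h | U (t + h)] 0^' --> (0 : C).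
  apply: cvg_trans; first exact: cvg_within.
  exact: nbhs_dnbhs.
have := @cvgD _ _ _ _ (dnbhs_within_filter U t) _ _ _ _
  (@cvgZ _ _ _ _ (dnbhs_within_filter U t) _ _ _ _ id0 dW)
  (@cvg_cst _ (W t) _ _ (dnbhs_within_filter U t)).
rewrite scale0r add0r; apply: (@cvg_eq_near _ _ _ (dnbhs_within_filter U t)).
apply: filterS (dnbhs_within_neq0 U t) => h h0.
by rewrite fctE scalerA mulfV// scale1r subrK.
Qed.

Lemma has_derivative_on_continuous m n U (W : C -> 'M[C]_(m, n)) t V :
  has_derivative_on U W t V -> continuous_along U W t.
Proof.
move=> /has_derivative_on_punctured H A At; have HA := H _ At.
change (nbhs (0 : C) (fun h => U (t + h) -> A (W (t + h)))).
have : nbhs (0 : C) (fun h => h != 0 -> U (t + h) -> A (W (t + h))) by exact: HA.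
apply: filterS => h; have [->|h0] := eqVneq h 0; last exact.
by move=> _ _; rewrite addr0; exact: nbhs_singleton.
Qed.

Lemma has_derivative_onB m n U (W1 W2 : C -> 'M[C]_(m, n)) t V1 V2 :
  has_derivative_on U W1 t V1 ->
  has_derivative_on U W2 t V2 ->
  has_derivative_on U (fun s => W1 s - W2 s) t (V1 - V2).
Proof.
move=> d1 d2; have := @cvgB _ _ _ _ (dnbhs_within_filter U t) _ _ _ _ d1 d2.
apply: (@cvg_eq_near _ _ _ (dnbhs_within_filter U t)).
apply: nearW => h; rewrite fctE -scalerBr; congr (_ *: _).
by rewrite [in LHS]opprB [in RHS]opprB addrACA [RHS]addrACA [- W1 t - _]addrC.
Qed.

Lemma has_derivative_on_mulmx m n p U (W : C -> 'M[C]_(m, n))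
    (Y : C -> 'M[C]_(n, p)) t V Z :
  has_derivative_on U W t V ->
  has_derivative_on U Y t Z ->
  has_derivative_on U (fun s => W s *m Y s) t (V *m Y t + W t *m Z).
Proof.
move=> dW dY; have cY := has_derivative_on_punctured dY.
have := @cvgD _ _ _ _ (dnbhs_within_filter U t) _ _ _ _
  (@cvg_mulmx _ _ _ (dnbhs_within_filter U t) _ _ _ _ _ _ _ dW cY)
  (@cvg_mulmx _ _ _ (dnbhs_within_filter U t) _ _ _ _ _ _ _
    (@cvg_cst _ (W t) _ _ (dnbhs_within_filter U t)) dY).
apply: (@cvg_eq_near _ _ _ (dnbhs_within_filter U t)); apply: nearW => h.
by rewrite fctE -scalemxAl -scalemxAr -scalerDr mulmxBl mulmxBr addrA subrK.
Qed.

End DerivativeAlong.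

(** * Uniqueness for linear equations *)

Section LinearUniqueness.
Context {R : realType}.
Local Notation C := (Cplx R).
Implicit Types (U : set C) (t h a b d : C).

Definition chord a b (s : R) : C := a + s%:C%C * (b - a).

Lemma chordD a b s r : chord a b (s + r) = chord a b s + r%:C%C * (b - a).
Proof. by rewrite /chord rmorphD/= mulrDl addrA. Qed.

Lemma chord0 a b : chord a b 0 = a. Proof. by rewrite /chord mul0r addr0. Qed.

Lemma chord1 a b : chord a b 1 = b.
Proof. by rewrite /chord mul1r addrC subrK. Qed.

Lemma cvg_real_complex (T : Type) (F : set_system T) {FF : Filter F}
    (f : T -> R) (l : R) :
  f @ F --> l -> (fun x => (f x)%:C%C : C) @ F --> (l%:C%C : C).
Proof. by move=> fl; apply: cvg_complex; [exact: fl|exact: (@cvg_cst R)]. Qed.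

Lemma cvg_Im (T : Type) (F : set_system T) {FF : Filter F} (f : T -> C) (l : C) :
  f @ F --> l -> (fun x => complex.Im (f x)) @ F --> complex.Im l.
Proof.
move=> fl; have H : (fun x => complex.Re (f x * 'i%C)) @ F --> complex.Re (l * 'i%C).
  by apply: cvg_Re; apply: cvgM; [exact: fl|exact: (@cvg_cst C)].
rewrite ReiNIm in H.
rewrite -[complex.Im l]opprK.
rewrite (_ : (fun x => complex.Im (f x)) = (fun x => - complex.Re (f x * 'i%C))).
  exact: (cvgN H).
by apply/funext => x; rewrite ReiNIm opprK.
Qed.

Lemma continuous_along_chord (V : topologicalType) U (f : C -> V) a b s :
  (forall r, 0 <= r <= 1 -> U (chord a b r)) ->
  continuous_along U f (chord a b s) ->
  (fun r => f (chord a b r)) @ within `[0, 1] (nbhs s) --> f (chord a b s).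
Proof.
move=> Uab fs A /fs HA.
have {}HA : nbhs (0 : C) (fun h => U (chord a b s + h) -> A (f (chord a b s + h))).
  by exact: HA.
change (nbhs s (fun r => `[0, 1]%classic r -> A (f (chord a b r)))).
have c0 : (fun r : R => (r - s)%:C%C * (b - a)) @ nbhs s --> (0 : C).
  rewrite -[X in _ --> X](mul0r (b - a)); apply: cvgM; last exact: (@cvg_cst C).
  rewrite (_ : 0 = 0%:C%C)//; apply: cvg_real_complex.
  rewrite -[X in _ --> X](subrr s).
  by apply: (@cvgB _ _ _ (nbhs s) _ id (cst s)); [exact: cvg_id|exact: (@cvg_cst R)].
have : nbhs s (fun r => U (chord a b s + (r - s)%:C%C * (b - a)) ->
  A (f (chord a b s + (r - s)%:C%C * (b - a)))) by exact: c0 _ HA.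
apply: filterS => r H r01.
have := H; rewrite -chordD addrC subrK; apply; apply: Uab.
by move: r01; rewrite /= in_itv.
Qed.

Lemma is_derive_cvg (f : R -> R) (s l : R) :
  (fun r => r^-1 * (f (s + r) - f s)) @ 0^' --> l -> is_derive s 1 f l.
Proof.
move=> fl; have E : (fun r : R => r^-1 *: ((f \o shift s) (r *: (1 : R)) - f s)) =
    (fun r => r^-1 * (f (s + r) - f s)).
  by apply/funext => r; rewrite /= (mulr1 r : r *: (1 : R) = r) [r + s]addrC.
apply: DeriveDef; first by rewrite /derivable E; exact: cvgP fl.
by rewrite /derive E; exact: (cvg_lim (@norm_hausdorff _ _) fl).
Qed.

(** The chain rule. For s strictly inside (0, 1) the increments r (b - a) stay in U for small r, and
    they avoid 0 when a != b; a degenerate chord makes the slope 0 and is treated apart. *)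
Lemma cvg_slope_chord m n U (z : C -> 'M[C]_(m, n)) V a b s i j :
  (forall r, 0 <= r <= 1 -> U (chord a b r)) -> 0 < s < 1 ->
  has_derivative_on U z (chord a b s) V ->
  (fun r => (r^-1)%:C%C * (z (chord a b (s + r)) i j - z (chord a b s) i j)) @ 0^' -->
    (b - a) * V i j.
Proof.
move=> Uab /andP[s0 s1] dz.
have [ba|ba] := eqVneq (b - a) 0.
  rewrite /chord ba mul0r; apply: (@cvg_eq_near _ _ _ _ (cst (0 : C))).
    by apply: nearW => r; rewrite !mulr0 subrr mulr0.
  exact: (@cvg_cst C).
have c0 : (fun r : R => r%:C%C * (b - a)) @ 0^' --> (0 : C).
  rewrite -[X in _ --> X](mul0r (b - a)); apply: cvgM; last exact: (@cvg_cst C).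
  by apply: cvg_real_complex; exact: nbhs_dnbhs.
have r0 : \forall r \near (0 : R)^', r != 0 by exact: nbhs_dnbhs_neq.
have cw : (fun r : R => r%:C%C * (b - a)) @ 0^' -->
    within [set h | U (chord a b s + h)] (0 : C)^'.
  move=> A HA.
  have {}HA : nbhs (0 : C) (fun h => h != 0 -> U (chord a b s + h) -> A h) by exact: HA.
  have rs1 : \forall r \near (0 : R)^', `|r| < s by exact: dnbhs0_lt.
  have rs2 : \forall r \near (0 : R)^', `|r| < 1 - s.
    by apply: dnbhs0_lt; rewrite subr_gt0.
  have rA : \forall r \near (0 : R)^', r%:C%C * (b - a) != 0 ->
      U (chord a b s + r%:C%C * (b - a)) -> A (r%:C%C * (b - a)) by exact: c0 _ HA.
  change (\forall r \near (0 : R)^', A (r%:C%C * (b - a))).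
  near=> r; have : r%:C%C * (b - a) != 0 -> U (chord a b s + r%:C%C * (b - a)) ->
    A (r%:C%C * (b - a)) by near: r.
  apply.
    rewrite mulf_neq0// -[X in _ != X]/(0%:C%C : C) (inj_eq (@complexI R)).
    by near: r.
  rewrite -chordD; apply: Uab.
  have : `|r| < s by near: r.
  have : `|r| < 1 - s by near: r.
  by rewrite !ltr_norml; lra.
have dzij := (cvg_mxP _ _).1 (cvg_comp _ _ cw dz) i j.
have F0 : Filter (0 : R)^' by exact: dnbhs_filter.
have := @cvgM _ _ _ F0 _ _ _ _ (@cvg_cst C (b - a) _ _ F0) (dzij F0).
apply: cvg_eq_near; near=> r.
have rn0 : r%:C%C != 0 :> C.
  by rewrite -[X in _ != X]/(0%:C%C : C) (inj_eq (@complexI R)); near: r.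
rewrite /= !mxE -chordD fmorphV/=; field.
by rewrite rn0 ba.
Unshelve. all: by end_near. Qed.

End LinearUniqueness.

(** * Gronwall's estimate along a chord *)

Section Uniqueness.
Context {R : realType}.
Local Notation C := (Cplx R).
Implicit Types (U : set C) (a b : C).

(** The squared Frobenius norm, chosen over the maximum norm because it is differentiable along a
    chord. *)
Definition sqnorm m n (M : 'M[C]_(m, n)) : R :=
  \sum_i \sum_j (complex.Re (M i j) ^+ 2 + complex.Im (M i j) ^+ 2).

Lemma sqnorm_eq0 m n (M : 'M[C]_(m, n)) : sqnorm M <= 0 -> M = 0.
Proof.
move=> M0.
have sq0 i j : 0 <= complex.Re (M i j) ^+ 2 + complex.Im (M i j) ^+ 2.
  by rewrite addr_ge0 ?sqr_ge0.
have : sqnorm M = 0.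
  by apply/eqP; rewrite eq_le M0/= sumr_ge0// => i _; exact: sumr_ge0.
move=> /psumr_eq0P H; apply/matrixP => i j.
have /psumr_eq0P /(_ _) := H (fun k _ => sumr_ge0 _ (fun l _ => sq0 k l)) i isT.
move=> /(_ (fun l _ => sq0 i l) j isT) /eqP.
rewrite paddr_eq0 ?sqr_ge0// !sqrf_eq0 mxE => /andP[/eqP re /eqP im].
by rewrite [LHS]complexE re im mulr0 addr0.
Qed.

Lemma is_derive_sum_fun n (h : 'I_n -> R -> R) (dh : 'I_n -> R) (x : R) :
  (forall i, is_derive x 1 (h i) (dh i)) ->
  is_derive x 1 (fun r => \sum_i h i r) (\sum_i dh i).
Proof. by move=> /is_derive_sum; rewrite fct_sumE. Qed.

Lemma is_derive_sqnorm m n U (z : C -> 'M[C]_(m, n)) V a b s :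
  (forall r, 0 <= r <= 1 -> U (chord a b r)) -> 0 < s < 1 ->
  has_derivative_on U z (chord a b s) V ->
  is_derive s 1 (fun r => sqnorm (z (chord a b r)))
    (\sum_i \sum_j 2 * complex.Re ((z (chord a b s) i j)^*%C * ((b - a) * V i j))).
Proof.
move=> Uab s01 dz; have F0 : Filter (0 : R)^' by exact: dnbhs_filter.
have dRe i j : is_derive s 1 (fun r => complex.Re (z (chord a b r) i j))
    (complex.Re ((b - a) * V i j)).
  apply: is_derive_cvg.
  have := @cvg_Re _ _ _ F0 _ _ (cvg_slope_chord (i := i) (j := j) Uab s01 dz).
  apply: cvg_eq_near; apply: nearW => r.
  by case: (z _ i j) => x y; case: (z _ i j) => x' y' /=; rewrite mul0r subr0.
have dIm i j : is_derive s 1 (fun r => complex.Im (z (chord a b r) i j))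
    (complex.Im ((b - a) * V i j)).
  apply: is_derive_cvg.
  have := @cvg_Im _ _ _ F0 _ _ (cvg_slope_chord (i := i) (j := j) Uab s01 dz).
  apply: cvg_eq_near; apply: nearW => r.
  by case: (z _ i j) => x y; case: (z _ i j) => x' y' /=; rewrite mul0r addr0.
apply: is_derive_sum_fun => i; apply: is_derive_sum_fun => j.
pose x r := complex.Re (z (chord a b r) i j).
pose y r := complex.Im (z (chord a b r) i j).
have H : is_derive s 1 (x ^+ 2 + y ^+ 2)
  ((2%:R * x s ^+ 1) *: complex.Re ((b - a) * V i j) +
   (2%:R * y s ^+ 1) *: complex.Im ((b - a) * V i j)) by exact: is_deriveD.
move: H; rewrite (_ : x ^+ 2 + y ^+ 2 = (fun r => x r ^+ 2 + y r ^+ 2)); last first.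
  by apply/funext => r; rewrite !fctE.
move=> H; apply: (is_derive_eq H); rewrite /x /y !expr1.
case: (z _ i j) => u v; case: ((b - a) * V i j) => u' v' /=.
by rewrite /GRing.scale/=; ring.
Qed.

(** From 2 |z_ij| |z_lj| <= |z_ij|^2 + |z_lj|^2: summed over i, j, l, each of the two squares
    contributes m times [sqnorm z], whence the factor 2 m. *)
Lemma sqnorm_derivative_le m n (z : 'M[C]_(m, n)) (K : 'M[C]_m) (d : C) (k : R) :
  (forall i j, `|K i j| <= k%:C%C) ->
  \sum_i \sum_j 2 * complex.Re ((z i j)^*%C * (d * (K *m z) i j)) <=
  (2 * m%:R * k * complex.Re `|d|) * sqnorm z.
Proof.
move=> Kk; pose N (x : C) : R := complex.Re `|x|.
have N0 x : 0 <= N x by exact: Re_norm_ge0.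
have Nsq x : N x ^+ 2 = complex.Re x ^+ 2 + complex.Im x ^+ 2.
  by rewrite /N normc_def/= sqr_sqrtr// addr_ge0 ?sqr_ge0.
have sqE : sqnorm z = \sum_i \sum_j N (z i j) ^+ 2.
  by apply: eq_bigr => i _; apply: eq_bigr => j _; rewrite Nsq.
apply: (@le_trans _ _ (\sum_i \sum_j \sum_l (k * N d) *
    (N (z i j) ^+ 2 + N (z l j) ^+ 2))).
  apply: ler_sum => i _; apply: ler_sum => j _.
  have : 2 * complex.Re ((z i j)^*%C * (d * (K *m z) i j)) <=
      2 * (N (z i j) * (N d * \sum_l k * N (z l j))).
    rewrite ler_wpM2l// (le_trans (ler_norm _))// -lecR (le_trans (normc_ge_Re _))//.
    rewrite !normrM normcJ !rmorphM/= -!normC_real ler_wpM2l// ler_wpM2l//.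
    rewrite mxE (le_trans (ler_norm_sum _ _ _))// rmorph_sum/=.
    by apply: ler_sum => l _; rewrite normrM rmorphM/= -normC_real ler_wpM2r.
  move=> /le_trans; apply.
  rewrite !mulr_sumr; apply: ler_sum => l _.
  (* The sign of k is read off an entry bound; the row index [i] in scope supplies such an entry
     even though m is arbitrary. *)
  have k0 : 0 <= k by rewrite -ler0c (le_trans _ (Kk i i)).
  rewrite -subr_ge0 (_ : _ - _ = (k * N d) * (N (z i j) - N (z l j)) ^+ 2); last by ring.
  by rewrite mulr_ge0 ?sqr_ge0// mulr_ge0.
rewrite sqE le_eqVlt; apply/orP; left; apply/eqP.
transitivity (k * N d * (\sum_i \sum_j \sum_(l < m) N (z i j) ^+ 2 +
   \sum_(i < m) \sum_j \sum_l N (z l j) ^+ 2)).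
  rewrite -big_split mulr_sumr; apply: eq_bigr => i _.
  rewrite -big_split mulr_sumr; apply: eq_bigr => j _.
  by rewrite -big_split mulr_sumr.
set S := (X in _ = _ * X).
have -> : \sum_i \sum_j \sum_(l < m) N (z i j) ^+ 2 = m%:R * S.
  rewrite /S mulr_sumr; apply: eq_bigr => i _; rewrite mulr_sumr; apply: eq_bigr => j _.
  by rewrite sumr_const card_ord [RHS]mulr_natl.
have -> : \sum_(i < m) \sum_j \sum_l N (z l j) ^+ 2 = m%:R * S.
  by rewrite sumr_const card_ord [X in X *+ _]exchange_big/= [RHS]mulr_natl.
by rewrite /N; ring.
Qed.

(** The sum of the entry norms is continuous on the compact [0, 1], so its maximum bounds every
    entry. *)
Lemma chord_bounded m n U (K : C -> 'M[C]_(m, n)) a b :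
  (forall r, 0 <= r <= 1 -> U (chord a b r)) ->
  (forall t, U t -> continuous_along U K t) ->
  exists k : R, forall r i j, 0 <= r <= 1 -> `|K (chord a b r) i j| <= k%:C%C.
Proof.
move=> Uab cK.
pose f r := \sum_i \sum_j complex.Re `|K (chord a b r) i j|.
have cf : {within `[0, 1], continuous f}.
  apply/subspace_continuousP => s s01.
  apply: (cvg_big (@add_continuous R)) => i _.
  apply: (cvg_big (@add_continuous R)) => j _.
  apply: cvg_Re; apply: cvg_norm.
  have Us : U (chord a b s) by apply: Uab; move: s01; rewrite /= in_itv.
  exact: ((cvg_mxP _ _).1 (continuous_along_chord Uab (cK _ Us))).
have [c _ fc] := EVT_max (@ler01 R) cf.
exists (f c) => r i j r01.
by rewrite (le_trans (normC_entry_le _ i j))// lecR fc.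
Qed.

Lemma cvg_sqr (T : Type) (F : set_system T) {FF : Filter F} (f : T -> R) (l : R) :
  f @ F --> l -> (fun x => f x ^+ 2) @ F --> l ^+ 2.
Proof. by move=> fl; under eq_fun do rewrite expr2; rewrite expr2; exact: cvgM. Qed.

Lemma linear_ode_chord m n U (z : C -> 'M[C]_(m, n)) (K : C -> 'M[C]_m) a b :
  (forall r, 0 <= r <= 1 -> U (chord a b r)) ->
  (forall t, U t -> has_derivative_on U z t (K t *m z t)) ->
  (forall t, U t -> continuous_along U K t) ->
  z a = 0 -> z b = 0.
Proof.
move=> Uab dz cK za0.
have [k Kk] := chord_bounded Uab cK.
pose c := 2 * m%:R * k * complex.Re `|b - a|.
pose f r := sqnorm (z (chord a b r)).
(* Gronwall: [g] is nonincreasing. *)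
pose g r := f r * expR (- c * r).
have dg (s : R) : 0 < s < 1 -> exists2 l : R, l <= 0 & is_derive s 1 g l.
  move=> s01; have s01' : 0 <= s <= 1 by case/andP: s01 => /ltW-> /ltW->.
  have df := is_derive_sqnorm Uab s01 (dz _ (Uab _ s01')).
  have de : is_derive s 1 (fun r => expR (- c * r)) (expR (- c * s) * - c).
    apply: (@is_derive1_comp _ expR (fun r => - c * r)).
    apply: is_derive_cvg; apply: (@cvg_eq_near _ _ _ _ (cst (- c))).
      have : \forall r \near (0 : R)^', r != 0 by exact: nbhs_dnbhs_neq.
      by apply: filterS => r r0 /=; field.
    exact: (@cvg_cst R).
  have := is_deriveM df de; set l := (X in is_derive _ _ _ X) => dg.
  exists l => //; rewrite /l /GRing.scale/=.
  have := sqnorm_derivative_le (z (chord a b s)) (b - a) (fun i j => Kk s i j s01').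
  rewrite -/c; set u := \sum_i _ => uc.
  rewrite -/(f s) (_ : _ + _ = expR (- c * s) * (u - c * f s)); last by ring.
  by rewrite pmulr_rle0 ?expR_gt0// subr_le0.
have cg : {within `[0, 1], continuous g}.
  apply/subspace_continuousP => s s01; apply: cvgM.
    have Us : U (chord a b s) by apply: Uab; move: s01; rewrite /= in_itv.
    have cz := continuous_along_chord Uab (has_derivative_on_continuous (dz _ Us)).
    apply: (cvg_big (@add_continuous R)) => i _.
    apply: (cvg_big (@add_continuous R)) => j _.
    have czij : (fun r => z (chord a b r) i j) @ within `[0, 1] (nbhs s) -->
      z (chord a b s) i j by exact: ((cvg_mxP _ _).1 cz).
    by apply: cvgD; apply: cvg_sqr; [exact: cvg_Re|exact: cvg_Im].
  apply: cvg_within_filter.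
  have : continuous (fun r : R => expR (- c * r)).
    move=> r; apply: (continuous_comp (f := fun r => - c * r)).
      exact: mulrl_continuous.
    exact: continuous_expR.
  exact.
(* This gives g 1 <= g 0 = 0; the exponential factor is positive, so the squared norm at b is at
   most 0. *)
have := @ler0_derive1_le_cc _ g 0 1 _ _ cg 1 0.
rewrite /g /f chord0 chord1 mulr0 expR0 mulr1 za0.
have -> : sqnorm (0 : 'M[C]_(m, n)) = 0.
  by apply: big1 => i _; apply: big1 => j _; rewrite mxE/= expr0n addr0.
move=> H; apply: sqnorm_eq0; rewrite -(pmulr_lle0 _ (expR_gt0 (- c * 1))).
apply: H; rewrite ?in_itv/= ?lexx ?ler01//.
- by move=> s; rewrite in_itv/= => /dg[l _ [+ _]].
- by move=> s; rewrite in_itv/= derive1E => /dg[l l0 [_ ->]].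
Qed.

End Uniqueness.

(** * Connectedness along chords *)

Section ChordTopology.
Context {R : realType}.
Local Notation C := (Cplx R).
Implicit Types (U S B : set C) (t h x y : C).

Lemma chord_continuous x y : continuous (chord x y : R -> C).
Proof.
move=> r; apply: (@cvgD _ _ _ (nbhs r)); first exact: (@cvg_cst C).
apply: cvgM; last exact: (@cvg_cst C).
by apply: cvg_real_complex; exact: cvg_id.
Qed.

Lemma norm_chordB x y (r : R) : 0 <= r <= 1 -> `|x - chord x y r| <= `|x - y|.
Proof.
move=> /andP[r0 r1]; rewrite /chord opprD addrA subrr add0r normrN normrM distrC.
rewrite ler_piMl//.
by rewrite ger0_norm ?ler0c// -[leRHS]/(1%:C%C : C) lecR.
Qed.

(** Connectedness of [0, 1], pulled back along the chord. The set B is clopen relative to S alone,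
    which is why the whole chord must lie in S. *)
Lemma clopen_chord S B x y : (forall r, 0 <= r <= 1 -> S (chord x y r)) ->
  (exists2 V, open V & B = S `&` V) -> (exists2 F, closed F & B = S `&` F) ->
  B x -> B y.
Proof.
move=> Sxy [V oV BV] [F cF BF] Bx.
have := @segment_connected R 0 1 (`[0, 1] `&` [set r | B (chord x y r)]).
have e01 : `[0, 1]%classic (0 : R) by rewrite /= in_itv/= lexx ler01.
have e11 : `[0, 1]%classic (1 : R) by rewrite /= in_itv/= lexx ler01.
have SE r : `[0, 1]%classic r -> S (chord x y r) by rewrite /= in_itv/= => /Sxy.
move=> H; have {}H : `[0, 1] `&` [set r | B (chord x y r)] = `[0, 1]%classic.
  apply: H.
  - by exists 0; split=> //=; rewrite chord0.
  - exists (chord x y @^-1` V).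
      by apply: open_comp => // r _; exact: chord_continuous.
    apply/seteqP; split=> r [r01 Br]; split=> //.
      by move: Br; rewrite /= BV => -[].
    by rewrite /= BV; split=> //; exact: SE.
  - exists (chord x y @^-1` F).
      by apply: closed_comp => // r _; exact: chord_continuous.
    apply/seteqP; split=> r [r01 Br]; split=> //.
      by move: Br; rewrite /= BF => -[].
    by rewrite /= BF; split=> //; exact: SE.
have : (`[0, 1] `&` [set r | B (chord x y r)]) 1 by rewrite H.
by case=> _ /=; rewrite chord1.
Qed.

(** In a real interval a single chord joins x to y. In an open connected set, chords inside a ball
    can be run in both directions, so P is locally constant and its truth set is clopen in U. *)
Lemma time_domain_chord_ind U (P : C -> Prop) x y : time_domain U ->
  (forall a b, (forall r, 0 <= r <= 1 -> U (chord a b r)) -> P a -> P b) ->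
  U x -> P x -> U y -> P y.
Proof.
move=> [[oU cU]|[I ->]] Pchord Ux Px Uy; last first.
  case: Ux Px => a Ia <- Pa; case: Uy => b Ib <-; apply: Pchord Pa => r /andP[r0 r1] /=.
  exists (a + r * (b - a)); last by rewrite /chord rmorphD/= rmorphM/= rmorphB.
  have [ab|ba] := leP a b.
    apply: (interval_is_interval Ia Ib).
    by rewrite lerDl mulr_ge0 ?subr_ge0//= -lerBrDl ler_piMl// subr_ge0.
  apply: (interval_is_interval Ib Ia).
  rewrite gerDl mulr_ge0_le0 ?subr_le0 ?(ltW ba)// andbT -lerBlDl.
  by rewrite -lerN2 -mulrN opprB ler_piMl// subr_ge0 ltW.
have PU a : U a -> \forall b \near a, U b /\ (P a <-> P b).
  move=> Ua; have /nbhs_ballP[e /= e0 eU] := open_nbhs_nbhs (conj oU Ua).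
  apply/nbhs_ballP; exists e => //= b ab; split; first exact: eU.
  have chU r : 0 <= r <= 1 -> U (chord a b r).
    move=> r01; apply: eU; rewrite -ball_normE/= (le_lt_trans (norm_chordB _ _ r01))//.
  split; apply: Pchord => // r r01.
  have -> : chord b a r = chord a b (1 - r) by rewrite /chord rmorphB/= rmorph1; ring.
  by apply: chU; case/andP: r01 => r0 r1; rewrite subr_ge0 r1 gerBl.
have oP (Q : C -> Prop) : (forall a, U a -> \forall b \near a, U b /\ (Q a <-> Q b)) ->
    open (U `&` [set z | Q z]).
  move=> QU; rewrite openE => a [Ua Qa]; rewrite /interior.
  by apply: filterS (QU a Ua) => b [Ub [+ _]] => /(_ Qa).
have UP : U `&` [set z | P z] = U `&` (U `&` [set z | P z]) by rewrite setIA setIid.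
have UnP : U `&` [set z | P z] = U `&` ~` (U `&` [set z | ~ P z]).
  apply/seteqP; split=> z [Uz Pz]; split=> //=; first by case.
  by apply: contrapT => nP; apply: Pz.
have UE : U `&` [set z | P z] = U.
  apply: cU; first by exists x.
    by exists (U `&` [set z | P z]) => //; exact: oP.
  exists (~` (U `&` [set z | ~ P z])) => //; apply: open_closedC; apply: oP => a Ua.
  apply: filterS (PU a Ua) => b [Ub [ab ba]]; split=> //.
  by split=> nP Pz; apply: nP; [apply: ba|apply: ab].
by have [] : (U `&` [set z | P z]) y by rewrite UE.
Qed.

End ChordTopology.

(** * Connectedness of the plane without isolated points *)

Section PuncturedConnected.
Context {R : realType}.
Local Notation C := (Cplx R).
Implicit Types (S B : set C) (t h x y : C).

Lemma nbhs_puncturedP (t : C) (P : C -> Prop) : nbhs t (fun v => v != t -> P v) <->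
  exists2 e : C, 0 < e & forall h, h != 0 -> `|h| < e -> P (t + h).
Proof.
split=> [/nbhs_ballP[e /= e0 eP]|[e e0 eP]].
  exists e => // h h0 he; apply: eP; last by rewrite -subr_eq0 addrC addKr.
  by rewrite -ball_normE/= opprD addrA subrr add0r normrN.
apply/nbhs_ballP; exists e => //= v; rewrite -ball_normE/= => tv vt.
rewrite -[v](addrNK t) addrC; apply: eP; first by rewrite subr_eq0.
by rewrite distrC.
Qed.

(** P may fail at t itself, so around a nearby u != t the neighbourhood is first shrunk to exclude
    t. *)
Lemma open_punctured (P : C -> Prop) : open [set t : C | nbhs t (fun v => v != t -> P v)].
Proof.
rewrite openE => t /nbhs_interior; apply: filterS => u Pu.
case: (eqVneq t u) Pu => [<-|ut] Pu; first exact: Pu.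
have vt : nbhs u (fun v => v != t).
  apply/nbhs_ballP; exists `|u - t| => /=; first by rewrite normr_gt0 subr_eq0 eq_sym.
  move=> v; rewrite -ball_normE/=; apply: contraTneq => ->.
  by rewrite ltxx.
by apply: filterS2 Pu vt => v Pv vt _; exact: Pv.
Qed.

(* If 0 lies between [h] and [k], then [k] is a negative multiple of [h], hence
   not a real multiple of [i h]. *)
Lemma punctured_chord (h k : C) : h != 0 -> k != 0 ->
  (forall r, 0 <= r <= 1 -> chord h k r != 0) \/
  (forall r, 0 <= r <= 1 -> chord h ('i%C * h) r != 0 /\ chord ('i%C * h) k r != 0).
Proof.
move=> h0 k0; case: (pselect (forall r, 0 <= r <= 1 -> chord h k r != 0)) => [|hk].
  by left.
right=> s s01; split; apply/eqP => E0.
  have : (Complex (1 - s) s : C) * h = 0.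
    by rewrite -[RHS]E0 /chord [Complex _ _]complexE/= rmorphB/= rmorph1; ring.
  move/eqP; rewrite mulf_eq0 (negbTE h0) orbF eq_complex/= => /andP[/eqP s1 /eqP s0].
  by move: s1; rewrite s0 subr0 => /eqP; rewrite oner_eq0.
apply: hk => r r01; apply/eqP => F0.
(* This combination of the two vanishing chord points eliminates k and leaves a complex multiple of
   h. *)
have : (Complex (s * (1 - r)) (- (r * (1 - s))) : C) * h = 0.
  transitivity (s%:C%C * chord h k r - r%:C%C * chord ('i%C * h) k s : C).
    rewrite /chord [Complex _ _]complexE/= rmorphN !rmorphM !rmorphB rmorph1.
    by ring.
  by rewrite E0 F0 !mulr0 subr0.
move/eqP; rewrite mulf_eq0 (negbTE h0) orbF eq_complex/= oppr_eq0 !mulf_eq0.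
case/andP=> /orP[/eqP s0|]; last first.
  rewrite subr_eq0 => /eqP r1 _; move: F0; rewrite -r1 chord1 => /eqP.
  by rewrite (negbTE k0).
move: E0; rewrite s0 chord0 => /eqP; rewrite mulf_eq0 (negbTE h0) orbF eq_complex/=.
by rewrite oner_eq0 andbF.
Qed.

(** In a punctured disc, x and y are joined by a chord avoiding the centre, or by two such chords
    through i x, which has the same modulus as x. *)
Lemma clopen_punctured S B t e x y : (forall h, h != 0 -> `|h| < e -> S (t + h)) ->
  (exists2 V, open V & B = S `&` V) -> (exists2 F, closed F & B = S `&` F) ->
  x != 0 -> `|x| < e -> y != 0 -> `|y| < e -> B (t + x) -> B (t + y).
Proof.
move=> Se oB cB x0 xe y0 ye.
have cB' u v : `|u| < e -> `|v| < e ->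
    (forall r, 0 <= r <= 1 -> chord u v r != 0) -> B (t + u) -> B (t + v).
  move=> ue ve uv0; apply: (clopen_chord _ oB cB) => r r01.
  have -> : chord (t + u) (t + v) r = t + chord u v r by rewrite /chord; ring.
  apply: Se; first exact: uv0.
  have /andP[r0 r1] := r01.
  rewrite (_ : chord u v r = (1 - r)%:C%C * u + r%:C%C * v); last first.
    by rewrite /chord rmorphB/= rmorph1; ring.
  have e0 : 0 <= e by rewrite (le_trans _ (ltW ue)).
  have [r00|rn0] := eqVneq r 0.
    by rewrite r00 subr0 mul0r addr0 mul1r.
  have rp : 0 < r%:C%C :> C by rewrite ltcR lt_def rn0.
  rewrite (le_lt_trans (ler_normD _ _))// !normrM.
  rewrite (ger0_norm (_ : 0 <= (1 - r)%:C%C)) ?ler0c ?subr_ge0// (gtr0_norm rp).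
  have -> : e = (1 - r)%:C%C * e + r%:C%C * e by rewrite -mulrDl -rmorphD/= subrK mul1r.
  by rewrite ler_ltD ?ltr_pM2l// ler_wpM2l ?ler0c ?subr_ge0// ltW.
have [xy|H] := punctured_chord x0 y0; first exact: cB'.
have ixe : `|'i%C * x| < e by rewrite normrM normC_i mul1r.
move=> Bx; apply: (@cB' ('i%C * x)) => // [r /H[]//|].
by apply: cB' Bx => // r /H[].
Qed.

(** A relatively clopen B is all or nothing on each small punctured disc. Hence [D B], the points
    with a punctured neighbourhood inside B, extends B across the missing points and is clopen in
    the plane, where any two points are joined by a chord. *)
Lemma connected_punctured_nbhs S :
  (forall t, nbhs t (fun v => v != t -> S v)) -> connected S.
Proof.
move=> Snear B [b Bb] oB cB.
have [V oV BV] := oB; have [F cF BF] := cB.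
pose D (P : C -> Prop) := [set t : C | nbhs t (fun v => v != t -> P v)].
have DD' t : D B t \/ D (~` B) t.
  have [e e0 Se] := (nbhs_puncturedP _ _).1 (Snear t).
  have n0 : e / 2 != 0 by rewrite mulf_neq0 ?invr_eq0 ?pnatr_eq0// gt_eqF.
  have ne : `|e / 2| < e.
    by rewrite gtr0_norm ?divr_gt0// ltr_pdivrMr// ltr_pMr// ltr1n.
  case: (pselect (B (t + e / 2))) => Bt; [left|right];
    apply/nbhs_puncturedP; exists e => // h h0 he.
    exact: (clopen_punctured Se oB cB n0 ne h0 he).
  by move=> Bh; apply: Bt; exact: (clopen_punctured Se oB cB h0 he n0 ne).
have nDD' t : D B t -> ~ D (~` B) t.
  move=> Dt D't.
  have : \forall v \near t^', False.
    have H : nbhs t (fun v => v != t -> False).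
      by apply: filterS2 Dt D't => v Bv nBv vt; exact: nBv vt (Bv vt).
    exact: H.
  by move/filter_ex => [].
have DT t : D B t.
  apply: (@clopen_chord _ setT (D B) b t) => //.
  - by exists (D B); [exact: open_punctured|rewrite setTI].
  - exists (~` D (~` B)); first exact/open_closedC/open_punctured.
    rewrite setTI; apply/seteqP; split=> u; first exact: nDD'.
    by have [] := DD' u.
  - have [Sb Vb] : (S `&` V) b by rewrite -BV.
    have Vnb : nbhs b V by exact: open_nbhs_nbhs.
    by apply: filterS2 Vnb (Snear b) => v Vv Sv vb; rewrite BV; split=> //; exact: Sv.
apply/seteqP; split=> [t|t St]; first by rewrite BV => -[].
rewrite BF; split=> //; apply: contrapT => Ft.
have Fnt : nbhs t (~` F) by apply: open_nbhs_nbhs; split=> //; exact: closed_openC.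
apply: (nDD' t (DT t)); apply: filterS Fnt => v Fv _.
by rewrite /= BF => -[].
Qed.

End PuncturedConnected.

(** * The linear flow and the Riccati equation *)

Local Opaque expmx.

Section DerivativeMore.
Context {R : realType}.
Local Notation C := (Cplx R).
Implicit Types (U : set C) (t h : C).

Lemma has_derivative_on_cst m n U (M : 'M[C]_(m, n)) t :
  has_derivative_on U (fun=> M) t 0.
Proof.
apply: (@cvg_eq_near _ _ _ (dnbhs_within_filter U t) (cst (0 : 'M[C]_(m, n)))).
  by apply: nearW => h; rewrite subrr scaler0.
exact: (@cvg_cst _ _ _ _ (dnbhs_within_filter U t)).
Qed.

Lemma has_derivative_on_usubmx m1 m2 n U (W : C -> 'M[C]_(m1 + m2, n)) t V :
  has_derivative_on U W t V ->
  has_derivative_on U (fun s => usubmx (W s)) t (usubmx V).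
Proof.
move=> /(@cvg_mxP _ _ _ (dnbhs_within_filter U t)) dW.
apply/(@cvg_mxP _ _ _ (dnbhs_within_filter U t)) => i j; rewrite mxE.
apply: (@cvg_eq_near _ _ _ (dnbhs_within_filter U t)) (dW _ j).
by apply: nearW => h; rewrite !mxE.
Qed.

Lemma has_derivative_on_dsubmx m1 m2 n U (W : C -> 'M[C]_(m1 + m2, n)) t V :
  has_derivative_on U W t V ->
  has_derivative_on U (fun s => dsubmx (W s)) t (dsubmx V).
Proof.
move=> /(@cvg_mxP _ _ _ (dnbhs_within_filter U t)) dW.
apply/(@cvg_mxP _ _ _ (dnbhs_within_filter U t)) => i j; rewrite mxE.
apply: (@cvg_eq_near _ _ _ (dnbhs_within_filter U t)) (dW _ j).
by apply: nearW => h; rewrite !mxE.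
Qed.

(** The group law reduces the derivative at t to the one at 0; restricting the increments to U only
    refines the filter. *)
Lemma has_derivative_on_expmx n m U (M : 'M[C]_n) (V : 'M[C]_(n, m)) t0 t :
  has_derivative_on U (fun s => expmx ((s - t0) *: M) *m V) t
    (M *m (expmx ((t - t0) *: M) *m V)).
Proof.
pose F := expmx ((t - t0) *: M) *m V; rewrite -[X in _ *m X]/F.
have H : (fun h => h^-1 *: (expmx (h *: M) - 1%:M) *m F) @ (0 : C)^' --> M *m F.
  by apply: cvg_mulmx; [exact: expmx_derivative0|exact: cvg_cst].
have {}H : (fun h => h^-1 *: (expmx (h *: M) - 1%:M) *m F) @
    within [set h | U (t + h)] (0 : C)^' --> M *m F.
  by apply: cvg_trans H; apply: cvg_app; exact: cvg_within.
apply: (@cvg_eq_near _ _ _ (dnbhs_within_filter U t)) H.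
apply: nearW => h.
have E : expmx ((t + h - t0) *: M) = expmx (h *: M) *m expmx ((t - t0) *: M).
  by rewrite -expmxD addrA [h + t]addrC.
rewrite E -scalemxAl mulmxBl mul1mx /F.
by move: (expmx (h *: M)) (expmx ((t - t0) *: M)) => E1 E2; rewrite mulmxA.
Qed.

Lemma continuous_along_mulmx_addl m n p U (K : 'M[C]_(m, p)) (L : 'M[C]_(n, p))
    (W : C -> 'M[C]_(m, n)) t :
  continuous_along U W t -> continuous_along U (fun s => K + W s *m L) t.
Proof.
move=> cW; apply: (@cvgD _ _ _ _ (nbhs_within_filter U t)).
  exact: (@cvg_cst _ _ _ _ (nbhs_within_filter U t)).
apply: (@cvg_mulmx _ _ _ (nbhs_within_filter U t)) => //.
exact: (@cvg_cst _ _ _ _ (nbhs_within_filter U t)).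
Qed.

Lemma continuous_along_mulmx_oppr m n p U (K : 'M[C]_(m, p)) (L : 'M[C]_(m, n))
    (W : C -> 'M[C]_(n, p)) t :
  continuous_along U W t -> continuous_along U (fun s => - (L *m W s + K)) t.
Proof.
move=> cW; apply: (@cvgN _ _ _ _ (nbhs_within_filter U t)).
apply: (@cvgD _ _ _ _ (nbhs_within_filter U t)); last first.
  exact: (@cvg_cst _ _ _ _ (nbhs_within_filter U t)).
apply: (@cvg_mulmx _ _ _ (nbhs_within_filter U t)) => //.
exact: (@cvg_cst _ _ _ _ (nbhs_within_filter U t)).
Qed.

End DerivativeMore.

(** * Matrix identities relating the Riccati and the linear equation *)

Section RiccatiAlgebra.
Context {K : comNzRingType} {p q : nat}.
Variables (A : 'M[K]_(p, q)) (B : 'M[K]_p) (C : 'M[K]_q) (D : 'M[K]_(q, p)).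
Implicit Types (W X : 'M[K]_(p, q)) (Y : 'M[K]_q).

(** For X = W Y this computes X' - W Y', the numerator of the quotient rule for X Y^-1. *)
Lemma riccati_numerator W Y :
  B *m (W *m Y) + A *m Y - W *m (- (D *m (W *m Y)) - C *m Y) =
  (A + B *m W + W *m C + W *m D *m W) *m Y.
Proof.
rewrite mulmxBr mulmxN !mulmxDl !mulmxA.
move: (B *m W *m Y) (A *m Y) (W *m D *m W *m Y) (W *m C *m Y) => a b c d.
by apply/matrixP => i j; rewrite !mxE; ring.
Qed.

(** The left side is the derivative of X - W Y when W solves the Riccati equation; the defect thus
    obeys a homogeneous linear equation. *)
Lemma riccati_defect W X Y :
  B *m X + A *m Y - ((A + B *m W + W *m C + W *m D *m W) *m Y +
                     W *m (- (D *m X) - C *m Y)) =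
  (B + W *m D) *m (X - W *m Y).
Proof.
rewrite !mulmxBr mulmxN !mulmxDl !mulmxA.
move: (B *m X) (A *m Y) (B *m W *m Y) (W *m C *m Y) (W *m D *m W *m Y) (W *m D *m X).
by move=> a b c d e f; apply/matrixP => i j; rewrite !mxE; ring.
Qed.

(** The right side has the shape that the product rule gives to the derivative of Y V with V
    constant; its last summand carries the derivative 0 of V. *)
Lemma riccati_kernel W Y (V : 'M[K]_q) :
  - (D *m W + C) *m (Y *m V) = (- (D *m (W *m Y)) - C *m Y) *m V + Y *m 0.
Proof. by rewrite mulmx0 addr0 -opprD !mulNmx !mulmxDl !mulmxA. Qed.

End RiccatiAlgebra.

(** With W frozen at t, and V and T taken at t + h, the slope of X - W Y times the inverse of T is
    the slope of the quotient. This avoids differentiating an inverse. *)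
Lemma slope_quotient (K : comUnitRingType) (p q : nat) (h : K)
    (W V X Z : 'M[K]_(p, q)) (Y T : 'M[K]_q) :
  T \in unitmx -> W *m Y = X -> V *m T = Z ->
  (h *: (Z - W *m T - (X - W *m Y))) *m invmx T = h *: (V - W).
Proof.
by move=> Tu <- <-; rewrite subrr subr0 -scalemxAl -mulmxBl mulmxK.
Qed.

Section Flow.
Context {R : realType} {p q : nat}.
Local Notation C := (Cplx R).
Variables (A : 'M[C]_(p, q)) (B : 'M[C]_p) (C0 : 'M[C]_q) (D : 'M[C]_(q, p)).
Variables (t0 : C) (W0 : 'M[C]_(p, q)).
Local Notation xi := (xi_mx A B C0 D).
Implicit Types (U : set C) (t h : C).

Definition flow t : 'M[C]_(p + q, q) :=
  expmx ((t - t0) *: xi) *m col_mx W0 1%:M.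

Definition numer t : 'M[C]_(p, q) := usubmx (flow t).
Definition denom t : 'M[C]_q := dsubmx (flow t).
Definition regular : set C := [set t | denom t \in unitmx].
Definition riccati_sol t : 'M[C]_(p, q) := numer t *m invmx (denom t).

Lemma flowE t : flow t = col_mx (numer t) (denom t).
Proof. by rewrite /numer /denom vsubmxK. Qed.

Lemma flow0 : flow t0 = col_mx W0 1%:M.
Proof. by rewrite /flow subrr expmx0 mul1mx. Qed.

Lemma numer0 : numer t0 = W0. Proof. by rewrite /numer flow0 col_mxKu. Qed.

Lemma denom0 : denom t0 = 1%:M. Proof. by rewrite /denom flow0 col_mxKd. Qed.

Lemma regular0 : regular t0.
Proof. by rewrite /regular/= denom0 unitmx1. Qed.

Lemma riccati_sol0 : riccati_sol t0 = W0.
Proof. by rewrite /riccati_sol numer0 denom0 invmx1 mulmx1. Qed.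

Lemma flow_shift t h : flow (t + h) = expmx (h *: xi) *m flow t.
Proof.
rewrite /flow (_ : t + h - t0 = h + (t - t0)); last by rewrite addrA [h + t]addrC.
rewrite expmxD; move: (expmx (h *: xi)) (expmx ((t - t0) *: xi)) => E1 E2.
by rewrite mulmxA.
Qed.

Lemma riccati_solM t : regular t -> riccati_sol t *m denom t = numer t.
Proof. by move=> St; rewrite /riccati_sol mulmxKV. Qed.

Lemma xi_flow t : xi *m flow t =
  col_mx (B *m numer t + A *m denom t) (- (D *m numer t) - C0 *m denom t).
Proof. by rewrite flowE /xi_mx mul_block_col !mulNmx. Qed.

Lemma has_derivative_on_flow U t : has_derivative_on U flow t (xi *m flow t).
Proof. exact: has_derivative_on_expmx. Qed.

Lemma has_derivative_on_numer U t :
  has_derivative_on U numer t (B *m numer t + A *m denom t).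
Proof.
by have := has_derivative_on_usubmx (@has_derivative_on_flow U t);
  rewrite xi_flow col_mxKu.
Qed.

Lemma has_derivative_on_denom U t :
  has_derivative_on U denom t (- (D *m numer t) - C0 *m denom t).
Proof.
by have := has_derivative_on_dsubmx (@has_derivative_on_flow U t);
  rewrite xi_flow col_mxKd.
Qed.

Local Opaque flow numer denom riccati_sol.

Lemma has_derivative_on_riccati_sol t : regular t ->
  has_derivative_on regular riccati_sol t
    (A + B *m riccati_sol t + riccati_sol t *m C0
       + riccati_sol t *m D *m riccati_sol t).
Proof.
move=> St; set W := riccati_sol t.
have FF := dnbhs_within_filter regular t.
have dN : has_derivative_on regular (fun s => numer s - W *m denom s) t
    (B *m numer t + A *m denom t -
     (0 *m denom t + W *m (- (D *m numer t) - C0 *m denom t))).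
  apply: has_derivative_onB; first exact: has_derivative_on_numer.
  apply: has_derivative_on_mulmx; first exact: has_derivative_on_cst.
  exact: has_derivative_on_denom.
have cD := has_derivative_on_punctured (@has_derivative_on_denom regular t).
have := @cvg_mulmx _ _ _ FF _ _ _ _ _ _ _ dN (@cvg_invmx _ _ _ FF _ _ _ St cD).
set L := (X in _ --> X); have -> : L = A + B *m W + W *m C0 + W *m D *m W.
  rewrite /L mul0mx add0r -(riccati_solM St) -/W -[RHS](mulmxK St); congr (_ *m _).
  exact: riccati_numerator.
apply: (@cvg_eq_near _ _ _ FF).
rewrite near_withinE; apply: nearW => h Sth.
have E1 : riccati_sol t *m denom t = numer t by exact: (riccati_solM St).
have S1 : regular (t + h) by exact: Sth.
have E2 : riccati_sol (t + h) *m denom (t + h) = numer (t + h).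
  exact: (riccati_solM S1).
have Su : denom (t + h) \in unitmx by exact: S1.
exact: (slope_quotient h^-1 Su E1 E2).
Qed.

End Flow.

Local Opaque flow numer denom riccati_sol.

(** * The maximal solution of the differential equation *)

Section ContinuousRiccati.
Context {R : realType} {p q : nat}.
Local Notation C := (Cplx R).
Variables (A : 'M[C]_(p, q)) (B : 'M[C]_p) (C0 : 'M[C]_q) (D : 'M[C]_(q, p)).
Variables (t0 : C) (W0 : 'M[C]_(p, q)).
Local Notation num := (numer A B C0 D t0 W0).
Local Notation den := (denom A B C0 D t0 W0).
Local Notation S := (regular A B C0 D t0 W0).
Local Notation sol := (riccati_sol A B C0 D t0 W0).
Implicit Types (U : set C) (W : C -> 'M[C]_(p, q)) (t h : C).

Lemma numer_continuous_solution U W t : continuous_solution A B C0 D U W ->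
  U t0 -> W t0 = W0 -> U t -> num t = W t *m den t.
Proof.
move=> [tU dW] Ut0 Wt0 Ut.
pose Z s := num s - W s *m den s.
pose K s := B + W s *m D.
suff : Z t = 0 by move/eqP; rewrite subr_eq0 => /eqP.
have dZ s : U s -> has_derivative_on U Z s (K s *m Z s).
  move=> Us; rewrite -(riccati_defect A B C0 D (W s) (num s) (den s)).
  apply: has_derivative_onB; first exact: has_derivative_on_numer.
  by apply: has_derivative_on_mulmx; [exact: dW|exact: has_derivative_on_denom].
have cK s : U s -> continuous_along U K s.
  move=> Us; apply: continuous_along_mulmx_addl.
  exact: has_derivative_on_continuous (dW s Us).
apply: (time_domain_chord_ind (P := fun s => Z s = 0) tU _ Ut0 _ Ut).
  by move=> a b Uab; exact: (linear_ode_chord Uab dZ cK).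
by rewrite /Z Wt0 numer0 denom0 mulmx1 subrr.
Qed.

Lemma continuous_solution_unique U W t : continuous_solution A B C0 D U W ->
  U t0 -> W t0 = W0 -> U t -> S t /\ W t = sol t.
Proof.
move=> UW Ut0 Wt0 Ut; have numE s := numer_continuous_solution UW Ut0 Wt0 (t := s).
have [tU dW] := UW.
suff St : S t.
  split=> //; have E : W t *m den t = sol t *m den t.
    by rewrite -numE// riccati_solM.
  have St' : den t \in unitmx by exact: St.
  by rewrite -[LHS](mulmxK St') E mulmxK.
(* The columns of [cokermx] span the right kernel. *)
pose V := cokermx (den t); pose Z s := den s *m V.
pose K s := - (D *m W s + C0).
have dZ s : U s -> has_derivative_on U Z s (K s *m Z s).
  move=> Us.
  have -> : K s *m Z s = (- (D *m num s) - C0 *m den s) *m V + den s *m 0.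
    by rewrite (numE s Us); exact: riccati_kernel.
  apply: has_derivative_on_mulmx; last exact: has_derivative_on_cst.
  exact: has_derivative_on_denom.
have cK s : U s -> continuous_along U K s.
  move=> Us; apply: continuous_along_mulmx_oppr.
  exact: has_derivative_on_continuous (dW s Us).
have : Z t0 = 0.
  apply: (time_domain_chord_ind (P := fun s => Z s = 0) tU _ Ut _ Ut0).
    by move=> a b Uab; exact: (linear_ode_chord Uab dZ cK).
  exact: mulmx_coker.
rewrite /Z denom0 mul1mx => V0.
rewrite /regular/= -row_free_unit -row_leq_rank.
have := mxrank_coker (den t); rewrite -/V V0 mxrank0 => /esym/eqP.
by rewrite subn_eq0.
Qed.

(** Restarting the flow at t makes the entry a constant combination of entries of e^((z - t) xi),
    whose expansions at t are known. *)
Lemma entire_at_denom t i j : entire_at t (fun z => den z i j).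
Proof.
have -> : (fun z => den z i j) = (fun z => \sum_k
    expmx ((z - t) *: xi_mx A B C0 D) (rshift p i) k * flow A B C0 D t0 W0 t k j).
  apply/funext => z; have := flow_shift A B C0 D t0 W0 t (z - t).
  rewrite (_ : t + (z - t) = z) ?[in LHS]flowE; last by rewrite addrC subrK.
  move=> /matrixP/(_ (rshift p i) j); rewrite [LHS]col_mxEd => ->.
  by rewrite mxE.
apply: entire_at_sum => k; apply: entire_atM; last exact: entire_at_cst.
exists (expmx_coeff (xi_mx A B C0 D) (rshift p i) k).
  exact: exp_type_expmx_coeff.
by move=> h; rewrite addrC addKr; exact: cvg_expmxZ.
Qed.

(** The point t is arbitrary, a pole included: this is the form needed for connectedness, and
    openness follows as well. *)
Lemma regular_punctured t : nbhs t (fun z => z != t -> S z).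
Proof.
have det_entire : entire_at t (fun z => \det (den z)).
  by apply: entire_at_det => i j; exact: entire_at_denom.
have := entire_at_isolated_zeros det_entire.
have ex : exists z, \det (den z) != 0 by exists t0; rewrite denom0 det1 oner_eq0.
move=> /(_ ex) H.
have {}H : nbhs (0 : C) (fun h => h != 0 -> \det (den (t + h)) != 0) by exact: H.
have /nbhs_ballP[e /= e0 He] := H; apply/nbhs_puncturedP; exists e => // h h0 he.
rewrite /regular/= unitmxE unitfE; apply: He => //.
by rewrite -ball_normE/= sub0r normrN.
Qed.

Lemma open_regular : open S.
Proof.
rewrite openE => t St; apply: filterS (regular_punctured t) => z Sz.
case: (pselect (z = t)) => [zt|/eqP zt]; last exact: Sz zt.
by rewrite zt; exact: St.
Qed.

Lemma riccati_sol_continuous : continuous_solution A B C0 D S sol.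
Proof.
split; last exact: has_derivative_on_riccati_sol.
left; split; first exact: open_regular.
apply: connected_punctured_nbhs; exact: regular_punctured.
Qed.

End ContinuousRiccati.

(** * The discrete equation *)

(** The two cases become an infinite and a finite endpoint of an interval. *)
Lemma first_failure (P : nat -> Prop) : (forall k, P k) \/
  exists n, forall k, (k < n)%N <-> forall m, (m <= k)%N -> P m.
Proof.
case: (pselect (forall k, P k)) => [|/existsNP[k nPk]]; [by left|right].
have ex : exists n, `[< ~ P n >] by exists k; exact/asboolP.
have [n /asboolP nPn nmin] := ex_minnP ex.
exists n => l; split=> [ln m ml|Pl].
  apply: contrapT => nPm; have := nmin m; rewrite asboolT// => /(_ isT).
  by rewrite leqNgt (leq_ltn_trans ml ln).
by rewrite ltnNge; apply/negP => nl; exact: nPn (Pl n nl).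
Qed.

Lemma largest_interval (P : int -> Prop) : P 0 -> exists J : interval int,
  [/\ 0 \in J, forall n, n \in J -> P n &
      forall n, (forall m, (0 <= m <= n) || (n <= m <= 0) -> P m) -> n \in J].
Proof.
move=> P0.
have [u uP] : exists u : itv_bound int, forall n : int,
    (BRight n <= u)%O <-> forall m : nat, m%:Z <= n -> P m%:Z.
  have [PT|[n nP]] := first_failure (fun k => P k%:Z).
    by exists +oo%O => n; split=> // _ m _; exact: PT.
  have n0 : (0 < n)%N by apply/nP => m; rewrite leqn0 => /eqP ->.
  (* [BLeft] as an upper bound excludes n, the first failure. *)
  exists (BLeft n%:Z) => -[k|k]; rewrite bnd_simp; last by split.
  by rewrite ltz_nat; split=> [/nP Pk m mk|Pk]; [exact: Pk|apply/nP].
have [l lP] : exists l : itv_bound int, forall n : int,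
    (l <= BLeft n)%O <-> forall m : nat, n <= - m%:Z -> P (- m%:Z).
  have [PT|[n nP]] := first_failure (fun k => P (- k%:Z)).
    by exists -oo%O => n; split=> // _ m _; exact: PT.
  (* P 0 makes the first failure positive; [BRight] as a lower bound then excludes -n. *)
  have n0 : (0 < n)%N by apply/nP => m; rewrite leqn0 => /eqP ->.
  exists (BRight (- n%:Z)) => -[k|k]; rewrite bnd_simp.
    split=> [_ m|_]; last by rewrite (lt_le_trans (y := 0))// oppr_lt0 ltz_nat.
    by case: m => [|m]; [rewrite oppr0|rewrite -NegzE].
  rewrite NegzE ltrN2 ltz_nat; split=> [/nP Pk m|Pk].
    by rewrite lerN2 lez_nat; exact: Pk.
  by apply/nP => m mk; apply: Pk; rewrite lerN2 lez_nat.
have JP n : n \in Interval l u <->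
    (forall m : nat, n <= - m%:Z -> P (- m%:Z)) /\
    (forall m : nat, m%:Z <= n -> P m%:Z).
  by rewrite itv_boundlr; split=> [/andP[/lP ? /uP]|[/lP ? /uP ?]] //; apply/andP.
exists (Interval l u); split.
- by apply/JP; split=> -[|m].
- by case=> k /JP[down up]; [exact: up|rewrite NegzE; apply: down; rewrite NegzE].
- move=> n Pn; apply/JP; split=> m nm; apply: Pn; apply/orP; [right|left].
    by rewrite nm oppr_le0.
  by rewrite nm.
Qed.

(** * The fractional linear action of G *)

Section DiscreteAlgebra.
Context {K : comUnitRingType} {p q : nat}.
Variable G : 'M[K]_(p + q).
Implicit Types (W X : 'M[K]_(p, q)) (Y : 'M[K]_q).

Lemma mul_blocks X Y : G *m col_mx X Y =
  col_mx (ulsubmx G *m X + ursubmx G *m Y) (dlsubmx G *m X + drsubmx G *m Y).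
Proof. by rewrite -{1}(submxK G) mul_block_col. Qed.

(** Since X = W Y, both blocks of the image carry Y as a right factor: Y' = (G21 W + G22) Y.
    Invertibility of Y' passes to the denominator, and Y cancels in the quotient. *)
Lemma fractional_forward W X Y W' X' Y' : Y \in unitmx -> W *m Y = X ->
  G *m col_mx X Y = col_mx X' Y' -> W' *m Y' = X' ->
  (Y' \in unitmx -> dlsubmx G *m W + drsubmx G \in unitmx /\
    W' = (ulsubmx G *m W + ursubmx G) *m invmx (dlsubmx G *m W + drsubmx G)).
Proof.
move=> Yu <-; rewrite mul_blocks => /eq_col_mx[<- <-]; rewrite !mulmxA -!mulmxDl.
set L := _ + drsubmx G; set M := _ + ursubmx G.
rewrite unitmx_mul => WLY /andP[Lu _]; split=> //.
have WL : W' *m L = M.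
  by move: WLY; rewrite mulmxA => /(congr1 (mulmx^~ (invmx Y))); rewrite !mulmxK.
by rewrite -WL mulmxK.
Qed.

Lemma fractional_unit W X Y X' Y' : Y \in unitmx -> W *m Y = X ->
  G *m col_mx X Y = col_mx X' Y' -> dlsubmx G *m W + drsubmx G \in unitmx ->
  Y' \in unitmx.
Proof.
move=> Yu <-; rewrite mul_blocks => /eq_col_mx[_ <-]; rewrite !mulmxA -!mulmxDl.
by rewrite unitmx_mul Yu andbT.
Qed.

(** With L = G21 W + G22 the equation reads G [W; 1] = [W'; 1] L. Multiplying by L^-1 Y' and
    cancelling G gives [X; Y] = [W; 1] L^-1 Y', so Y = L^-1 Y' is invertible. *)
Lemma fractional_backward W X Y W' X' Y' : G \in unitmx -> Y' \in unitmx ->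
  W' *m Y' = X' -> G *m col_mx X Y = col_mx X' Y' ->
  dlsubmx G *m W + drsubmx G \in unitmx ->
  W' = (ulsubmx G *m W + ursubmx G) *m invmx (dlsubmx G *m W + drsubmx G) ->
  Y \in unitmx /\ W *m Y = X.
Proof.
move=> Gu Yu <- GXY; set L := _ + drsubmx G => Lu WE.
have GW : G *m col_mx W 1%:M = col_mx W' 1%:M *m L.
  by rewrite mul_blocks !mulmx1 -/L mul_col_mx mul1mx WE mulmxKV.
have : G *m (col_mx W 1%:M *m (invmx L *m Y')) = G *m col_mx X Y.
  by rewrite GXY mulmxA GW -mulmxA mulKVmx// mul_col_mx mul1mx.
move=> /(congr1 (mulmx (invmx G))); rewrite !mulKmx// mul_col_mx mul1mx.
move=> /eq_col_mx[<- <-]; split=> //.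
by rewrite unitmx_mul unitmx_inv Lu.
Qed.

End DiscreteAlgebra.

Section DiscreteRiccati.
Context {R : realType} {p q : nat}.
Local Notation C := (Cplx R).
Variables (A : 'M[C]_(p, q)) (B : 'M[C]_p) (C0 : 'M[C]_q) (D : 'M[C]_(q, p)).
Variables (t0 sigma : C) (W0 : 'M[C]_(p, q)).
Local Notation num := (numer A B C0 D t0 W0).
Local Notation den := (denom A B C0 D t0 W0).
Local Notation S := (regular A B C0 D t0 W0).
Local Notation sol := (riccati_sol A B C0 D t0 W0).
Local Notation G := (expmx (sigma *: xi_mx A B C0 D)).
Implicit Types (T : set C) (W : C -> 'M[C]_(p, q)) (t : C).

Lemma flow_step t : G *m col_mx (num t) (den t) =
  col_mx (num (t + sigma)) (den (t + sigma)).
Proof.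
have := flow_shift A B C0 D t0 W0 t sigma; rewrite !flowE.
exact: esym.
Qed.

Lemma discrete_equation_riccati_sol t : S t -> S (t + sigma) ->
  discrete_equation G sigma sol t.
Proof.
move=> St Ss.
have E : sol t *m den t = num t by exact: riccati_solM.
have Es : sol (t + sigma) *m den (t + sigma) = num (t + sigma) by exact: riccati_solM.
exact: (fractional_forward St E (flow_step t) Es Ss).
Qed.

Lemma discrete_equation_forward W t : S t -> W t = sol t ->
  discrete_equation G sigma W t -> S (t + sigma) /\ W (t + sigma) = sol (t + sigma).
Proof.
move=> St Wt [Lu WE].
have E : W t *m den t = num t by rewrite Wt; exact: riccati_solM.
have Ss : S (t + sigma) by exact: (fractional_unit St E (flow_step t) Lu).
have [_ solE] := discrete_equation_riccati_sol St Ss.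
split; first exact: Ss.
by rewrite WE Wt; exact: esym solE.
Qed.

Lemma discrete_equation_backward W t :
  S (t + sigma) -> W (t + sigma) = sol (t + sigma) ->
  discrete_equation G sigma W t -> S t /\ W t = sol t.
Proof.
move=> Ss Ws [Lu WE].
have E : W (t + sigma) *m den (t + sigma) = num (t + sigma).
  by rewrite Ws; exact: riccati_solM.
have [St EW] : den t \in unitmx /\ W t *m den t = num t.
  exact: (fractional_backward (expmx_unit _ _) Ss E (flow_step t) Lu WE).
split; first exact: St.
have Et : sol t *m den t = num t by exact: riccati_solM.
by apply: (can_inj (mulmxK St)); exact: etrans EW (esym Et).
Qed.

Lemma discrete_solution_unique T W : sigma != 0 ->
  discrete_solution G t0 sigma T W -> T t0 -> W t0 = W0 -> forall J : interval int,
  T = [set t0 + sigma *~ n | n in [set` J]] ->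
  0 \in J /\ forall n, n \in J -> S (t0 + sigma *~ n) /\
    W (t0 + sigma *~ n) = sol (t0 + sigma *~ n).
Proof.
move=> sigma0 [_ dW] Tt0 Wt0 J TJ.
have J0 : 0 \in J.
  (* As sigma != 0, the index of a lattice point is unique, so t0 in T means 0 in J. *)
  move: Tt0; rewrite TJ => -[n /= nJ /eqP].
  rewrite -subr_eq0 addrAC subrr add0r mulrz_eq0 (negbTE sigma0) orbF.
  by move=> /eqP n0; rewrite -n0.
split=> //.
have step (n : int) : n \in J -> n + 1 \in J ->
    discrete_equation G sigma W (t0 + sigma *~ n).
  have sE : t0 + sigma *~ n + sigma = t0 + sigma *~ (n + 1).
    by rewrite mulrzDr mulr1z addrA.
  move=> nJ n1J; apply: dW; rewrite TJ; first by exists n.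
  by rewrite sE; exists (n + 1).
have S0 : S (t0 + sigma *~ 0) /\ W (t0 + sigma *~ 0) = sol (t0 + sigma *~ 0).
  rewrite mulr0z addr0; split; first exact: regular0.
  by rewrite Wt0 riccati_sol0.
have up (k : nat) : k%:Z \in J ->
    S (t0 + sigma *~ k%:Z) /\ W (t0 + sigma *~ k%:Z) = sol (t0 + sigma *~ k%:Z).
  elim: k => [_|k IH kJ]; first exact: S0.
  have kJ' : k%:Z \in J.
    by apply: (interval_is_interval J0 kJ); rewrite /= lez_nat leqnSn.
  have [Sk Wk] := IH kJ'.
  have kE : k.+1%:Z = k%:Z + 1 by rewrite -addn1 PoszD.
  rewrite kE mulrzDr mulr1z addrA.
  by apply: discrete_equation_forward => //; apply: step => //; rewrite -kE.
have down (k : nat) : - k%:Z \in J ->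
    S (t0 + sigma *~ - k%:Z) /\ W (t0 + sigma *~ - k%:Z) = sol (t0 + sigma *~ - k%:Z).
  elim: k => [_|k IH kJ]; first by rewrite oppr0; exact: S0.
  have kJ' : - k%:Z \in J.
    apply: (interval_is_interval kJ J0).
    by rewrite lerN2 lez_nat leqnSn oppr_le0.
  have [Sk Wk] := IH kJ'.
  have kE : - k%:Z = - k.+1%:Z + 1 by rewrite -addn1 PoszD opprD subrK.
  have tE : t0 + sigma *~ - k%:Z = t0 + sigma *~ - k.+1%:Z + sigma.
    by rewrite kE mulrzDr mulr1z addrA.
  rewrite tE in Sk Wk.
  by apply: discrete_equation_backward => //; apply: step => //; rewrite -kE.
by case=> k; [exact: up|rewrite NegzE; exact: down].
Qed.

End DiscreteRiccati.

(** One family [Phi] serves both equations, parametrised by the same initial value; this is the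
    coincidence of general solutions. The last clause covers regular lattice steps lying outside the
    run [T W0], and steps off the lattice through t0. *)
Theorem theorem2 (R : realType) (p q : nat) (hp : (1 <= p)%N) (hq : (1 <= q)%N)
    (A : 'M[Cplx R]_(p, q)) (B : 'M[Cplx R]_p)
    (C : 'M[Cplx R]_q) (D : 'M[Cplx R]_(q, p))
    (htr : \tr B = \tr C)
    (t0 sigma : Cplx R) (hsigma : sigma != 0) :
  let G := expmx (sigma *: xi_mx A B C D) in
  exists (S T : 'M[Cplx R]_(p, q) -> set (Cplx R))
         (Phi : 'M[Cplx R]_(p, q) -> Cplx R -> 'M[Cplx R]_(p, q)),
    [/\ general_solution (continuous_solution A B C D) t0 S Phi,
        general_solution (discrete_solution G t0 sigma) t0 T Phi,
        forall W0, T W0 `<=` S W0 &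
        forall W0 t, S W0 t -> S W0 (t + sigma) ->
          discrete_equation G sigma (Phi W0) t].
Proof.
move=> G.
pose S := regular A B C D t0; pose Phi := riccati_sol A B C D t0.
have /choice[J HJ] : forall W0, exists J : interval int,
    [/\ 0 \in J, forall n : int, n \in J -> S W0 (t0 + sigma *~ n) &
     forall n : int, (forall m : int, (0 <= m <= n) || (n <= m <= 0) ->
       S W0 (t0 + sigma *~ m)) -> n \in J].
  move=> W0; apply: (largest_interval (P := fun n => S W0 (t0 + sigma *~ n))).
  by rewrite mulr0z addr0; exact: regular0.
pose T W0 := [set t0 + sigma *~ n | n in [set` J W0]].
have TS W0 : T W0 `<=` S W0.
  by move=> _ [n nJ <-]; have [_ + _] := HJ W0; apply.
exists S, T, Phi; split.
- move=> W0; split.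
  + exact: riccati_sol_continuous.
  + exact: regular0.
  + exact: riccati_sol0.
  + move=> U W UW Ut0 Wt0; split=> t Ut.
      exact: (continuous_solution_unique UW Ut0 Wt0 Ut).1.
    exact: (continuous_solution_unique UW Ut0 Wt0 Ut).2.
- move=> W0; have [J0 JS JP] := HJ W0; split.
  + split; first by exists (J W0).
    move=> t Tt Ts; have St : S W0 t by exact: (TS W0 t Tt).
    have Ss : S W0 (t + sigma) by exact: (TS W0 _ Ts).
    exact: (discrete_equation_riccati_sol St Ss).
  + by exists 0 => //; rewrite mulr0z addr0.
  + exact: riccati_sol0.
  + move=> U W UW Ut0 Wt0; have [[J' UJ'] _] := UW.
    have [J'0 J'S] := discrete_solution_unique hsigma UW Ut0 Wt0 UJ'.
    rewrite {}UJ'; split=> _ [n /= nJ' <-]; last exact: (J'S n nJ').2.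
    (* All integers between 0 and n lie in J', so their lattice points are regular, and maximality
       of the run puts n in it. *)
    exists n => //=; apply: JP => m mn; apply: (J'S m _).1.
    case/orP: mn => mn; first exact: (interval_is_interval J'0 nJ').
    exact: (interval_is_interval nJ' J'0).
- exact: TS.
- by move=> W0 t St Ss; exact: (discrete_equation_riccati_sol St Ss).
Qed.
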